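(* Let $G(V,E)$ be a connected planar trivalent graph and $\Gamma$ a plane graph for $G$. Then the Euler characteristic of its filtered $2$-color vertex homology (over $\mathbb{C}$) satisfies $$\chi(\widehat{VCH}_2^*(\Gamma)) = 2^{\frac12 |V|} \cdot \# \{ \text{3-edge-colorings of }\Gamma\}.$$
   Context: Graphs are finite multigraphs: loops and multiple edges are allowed, and so are ''vertex-less'' edges (circles, also regarded as loops). Trivalent means every vertex has degree 3 (a loop at a vertex counts twice). A 3-edge-coloring is an assignment of one of three fixed colors to each edge so that the three half-edges at each vertex have distinct colors. Ribbon graphs. A ribbon graph $\Gamma$ of $G$ is a surface with boundary in which $G$ is embedded and which deformation retracts onto $G$; combinatorially, a disc for each vertex and a band for each edge, with a cyclic order of half-edges at each vertex and possibly half-twisted bands (a vertex-less edge gives an annulus or Möbius band). Capping the boundary circles by discs gives a closed surface $\overline\Gamma$. A plane graph is an embedding of a connected planar graph into the sphere, i.e. a ribbon graph with $\overline\Gamma=S^2$. States. Let $H$ be the set of half-edges (pairs of an edge and one of its ends at a vertex). For $\alpha\in\{0,1\}^H$, $\Gamma_\alpha$ is obtained from $\Gamma$ by inserting, for each $h$ with $\alpha_h=1$, one half-twist in the band of the edge containing $h$. For $\nu\in\{0,1\}^V$ let $\alpha(\nu)_h=\nu_v$ where $v$ is the vertex of $h$, $\Gamma_\nu:=\Gamma_{\alpha(\nu)}$, $|\nu|=\sum_v\nu_v$. Circles of a state are its boundary circles. Filtered $n$-color vertex homology (here $n=2$). Let $m=n/2$ if $n$ is even, $m=(n-1)/2$ if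 $n$ is odd, $\widehat A=\mathbb{C}[x]/(x^n-1)$, with $\widehat\mu$ the multiplication, $\widehat\Delta(x^k)=\sum_{0\le i,j<n,\ i+j\equiv k+2m\ (n)}x^i\otimes x^j$, $\widehat\eta(x^k)=\sqrt n\,x^{k+m}$. Put $\widehat A_\alpha=\widehat A^{\otimes(\text{circles of }\Gamma_\alpha)}$. If $\alpha'$ is obtained from $\alpha$ by changing one coordinate from 0 to 1, the half-twist merges two circles, splits one circle into two, or changes one circle to one circle; $\widehat\partial_{\alpha\alpha'}$ applies $\widehat\mu,\widehat\Delta,\widehat\eta$ respectively on affected factors and the identity elsewhere. If $\nu'$ is obtained from $\nu$ by changing one coordinate from 0 to 1, $\widehat\delta_{\nu\nu'}$ is the composition of three maps $\widehat\partial$ along any 3-step path from $\alpha(\nu)$ to $\alpha(\nu')$ (independent of the path). Ordering $V$, let $\widehat C_n^i(\Gamma)=\bigoplus_{|\nu|=i}\widehat A_{\alpha(\nu)}$ and $\widehat\delta=\sum_{\nu'}(-1)^s\widehat\delta_{\nu\nu'}$ on the $\nu$-summand, with $s$ the number of 1's of $\nu$ before the changed coordinate. $\widehat{VCH}_n^i(\Gamma)$ is the homology of $(\widehat C_n^*(\Gamma),\widehat\delta)$ at $i$, and $\chi(\widehat{VCH}_n^*(\Gamma))=\sum_i(-1)^i\dim_{\mathbb{C}}\widehat{VCH}_n^i(\Gamma)$.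
   Formalization: The graph is assumed to have at least one vertex: for the single vertex-less circle (vacuously trivalent, plane graph an annulus) the Euler characteristic is 4 while there are 3 edge colorings, so the formula fails there. *)

(* Defs.v *)
From HB Require Import structures.
From mathcomp Require Import all_boot all_order all_fingroup all_algebra.

Set Implicit Arguments.
Unset Strict Implicit.
Unset Printing Implicit Defensive.

Import Order.TTheory GRing.Theory Num.Theory.
Local Open Scope ring_scope.

(* Finite multigraphs. The edges are the [band]s, whose two ends [(e, false)]
   and [(e, true)] are attached to vertices (possibly the same one), together
   with the vertex-less edges [loop]. *)
Record multigraph := Multigraph {
  vertex : finType;
  band : finType;
  loop : finType;
  endpoint : band * bool -> vertex }.

Definition edge (G : multigraph) : finType := (band G + loop G)%type.
Definition half_edge (G : multigraph) : finType := (band G * bool)%type.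

Section Graphs.
Variable G : multigraph.

Definition other_half (h : half_edge G) : half_edge G := (h.1, ~~ h.2).

Definition half_edges_at (v : vertex G) : {set half_edge G} :=
  [set h | endpoint h == v].

Definition trivalent : Prop := forall v : vertex G, #|half_edges_at v| = 3%N.

Definition adjacent : rel (vertex G + loop G) := fun x y =>
  match x, y with
  | inl v, inl w => [exists h, (endpoint h == v) && (endpoint (other_half h) == w)]
  | _, _ => false
  end.

Definition connected : Prop :=
  (0 < #|{: vertex G + loop G}|)%N /\ forall x y, connect adjacent x y.

Definition edge_coloring3 (c : {ffun edge G -> 'I_3}) : bool :=
  [forall h : half_edge G, forall h' : half_edge G,
    (endpoint h == endpoint h') && (h != h') ==> (c (inl h.1) != c (inl h'.1))].

End Graphs.

(* [rot] is the cyclic order of the half-edges at each vertex; [twist] and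
   [loop_twist] hold the parities of the numbers of half-twists, so that
   [loop_twist c] tells a Moebius band from an annulus. *)
Record ribbon_graph (G : multigraph) := RibbonGraph {
  rot : {perm half_edge G};
  twist : {ffun band G -> bool};
  loop_twist : {ffun loop G -> bool};
  rotP : forall h, porbit rot h = half_edges_at (endpoint h) }.

Section Boundary.
Variables (G : multigraph) (Gamma : ribbon_graph G).

(* Points marked on the boundary of a ribbon graph: the corner of the vertex
   disc where the side [s] of the half-edge [h] begins ([s = true] for the side
   facing [rot h]), the two sides of each loop, and one point for each disc
   without half-edges. *)
Definition bpoint : finType :=
  (half_edge G * bool + (loop G * bool + {v : vertex G | half_edges_at v == set0}))%type.

(* Two marked points are adjacent when an arc of a vertex disc, or a side of a
   band or loop, joins them. Since the local orientations of the two discs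
   read the sides in opposite ways, an untwisted band exchanges [s] and
   [~~ s]. *)
Definition badj : rel bpoint := fun p q =>
  match p, q with
  | inl (h, s), inl (h', s') =>
      [|| [&& s, ~~ s' & h' == rot Gamma h],
          [&& ~~ s, s' & h == rot Gamma h'] |
          (h' == other_half h) && (s' == s (+) ~~ twist Gamma h.1)]
  | inr (inl (c, s)), inr (inl (c', s')) =>
      (c' == c) && (s' == s (+) loop_twist Gamma c)
  | _, _ => false
  end.

Definition boundary : {set {set bpoint}} :=
  equivalence_partition (connect badj) [set: bpoint].

Definition circle : finType := {c : {set bpoint} | c \in boundary}.

(* The closed surface obtained by capping off has the vertices of [G], its
   bands as edges and the capping discs as faces; an annulus or Moebius band
   has Euler characteristic 0. *)
Definition capped_euler : int :=
  #|vertex G|%:Z - #|band G|%:Z + #|boundary|%:Z.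

(* Suitable flips of the vertex discs make every band untwisted. *)
Definition orientable : Prop :=
  (exists o : vertex G -> bool, forall e,
     twist Gamma e = o (endpoint (e, false)) (+) o (endpoint (e, true)))
  /\ forall c, loop_twist Gamma c = false.

(* The capped surface is the sphere, described through the classification of
   closed surfaces. *)
Definition plane : Prop := [/\ connected G, orientable & capped_euler = 2].

End Boundary.

Definition planar (G : multigraph) : Prop :=
  exists Gamma : ribbon_graph G, plane Gamma.

Section States.
Variables (G : multigraph) (Gamma : ribbon_graph G).

Definition state : finType := {ffun half_edge G -> bool}.
Definition vstate : finType := {ffun vertex G -> bool}.

Definition add_twists (alpha : state) : ribbon_graph G :=
  @RibbonGraph G (rot Gamma)
    [ffun e => twist Gamma e (+) alpha (e, false) (+) alpha (e, true)]
    (loop_twist Gamma) (rotP Gamma).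

Definition alpha_of (nu : vstate) : state := [ffun h => nu (endpoint h)].

Definition weight (nu : vstate) : nat := #|[set v | nu v]|.

Definition raise (nu : vstate) (v : vertex G) : vstate :=
  [ffun w => nu w || (w == v)].

Definition ones_before (nu : vstate) (v : vertex G) : nat :=
  #|[set w | nu w && (enum_rank w < enum_rank v)%N]|.

(* The states strictly between [alpha_of nu] and [alpha_of (raise nu v)] on a
   path that changes the half-edges at [v] one at a time, in the order of
   [enum]. *)
Definition path_at (nu : vstate) (v : vertex G) : seq state :=
  let hs := enum (half_edges_at v) in
  [seq [ffun h => alpha_of nu h || (h \in take j hs)] | j <- iota 1 (size hs).-1].

End States.

Section FreeSpaces.
Variable F : fieldType.

Definition free_space (I : finType) : vectType F := {ffun I -> F^o}.

Definition basis_vector (I : finType) (i : I) : free_space I :=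
  [ffun j => (j == i)%:R].

Section LinearMaps.
Variables (I J : finType) (a : I -> J -> F).

Definition coef_fun (f : free_space I) : free_space J :=
  [ffun j => \sum_i f i * a i j].

Fact coef_fun_is_linear : linear coef_fun.
Proof.
move=> c f g; apply/ffunP => j; rewrite !ffunE scaler_sumr -big_split /=.
by apply: eq_bigr => i _; rewrite !ffunE mulrDl -scalerAl.
Qed.

HB.instance Definition _ := GRing.isLinear.Build F (free_space I) (free_space J)
  _ coef_fun coef_fun_is_linear.

(* The linear map sending the basis vector [i] to [\sum_j a i j * j]. *)
Definition linear_of : 'Hom(free_space I, free_space J) := linfun coef_fun.

End LinearMaps.
End FreeSpaces.

Section Homology.
Variables (F : numClosedFieldType) (n : nat).
Variables (G : multigraph) (Gamma : ribbon_graph G).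

(* Structure constants in the basis x^0, ..., x^(n-1) of F[x]/(x^n - 1): the
   coefficients of x^k in x^i x^j, of x^i (x) x^j in Delta(x^k), and of x^l in
   eta(x^k). *)
Definition mu_coef (i j k : 'I_n) : F := (k == i + j %[mod n])%N%:R.
Definition Delta_coef (k i j : 'I_n) : F := (i + j == k + 2 * n./2 %[mod n])%N%:R.
Definition eta_coef (k l : 'I_n) : F :=
  sqrtC n%:R * (l == k + n./2 %[mod n])%N%:R.

(* The tensor power of F[x]/(x^n - 1) over the circles of a state has as basis
   the monomials, that is, the assignments of an exponent to each circle. *)
Definition monomial (alpha : state G) : finType :=
  {ffun circle (add_twists Gamma alpha) -> 'I_n}.
Definition hatA (alpha : state G) : vectType F := free_space F (monomial alpha).

(* The circles of [alpha] running along the half-edges where [alpha] and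
   [alpha'] differ. *)
Definition affected (alpha alpha' : state G) :
    {set circle (add_twists Gamma alpha)} :=
  [set c : circle (add_twists Gamma alpha) |
    [exists h, (alpha h != alpha' h) &&
      [exists s, (inl (h, s) : bpoint G) \in val c]]].

Definition agree_unaffected (alpha alpha' : state G)
    (k : monomial alpha) (k' : monomial alpha') : bool :=
  [forall c, forall c',
    [&& c \notin affected alpha alpha', c' \notin affected alpha' alpha
      & val c == val c'] ==> (k c == k' c')].

Definition hat_partial_coef (alpha alpha' : state G)
    (k : monomial alpha) (k' : monomial alpha') : F :=
  (agree_unaffected k k')%:R *
  match enum (affected alpha alpha'), enum (affected alpha' alpha) with
  | [:: c1; c2], [:: c'] => mu_coef (k c1) (k c2) (k' c')
  | [:: c], [:: c1'; c2'] => Delta_coef (k c) (k' c1') (k' c2')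
  | [:: c], [:: c'] => eta_coef (k c) (k' c')
  | _, _ => 0
  end.

(* Meaningful when [alpha'] is obtained from [alpha] by changing one coordinate
   from 0 to 1. *)
Definition hat_partial (alpha alpha' : state G) :
    'Hom(hatA alpha, hatA alpha') :=
  linear_of (@hat_partial_coef alpha alpha').

Fixpoint hat_partial_along (alpha : state G) (p : seq (state G))
    (alpha' : state G) : 'Hom(hatA alpha, hatA alpha') :=
  if p is beta :: p' then
    (hat_partial_along beta p' alpha' \o hat_partial alpha beta)%VF
  else hat_partial alpha alpha'.

Definition hat_delta_at (nu : vstate G) (v : vertex G) (nu' : vstate G) :
    'Hom(hatA (alpha_of nu), hatA (alpha_of nu')) :=
  hat_partial_along (alpha_of nu) (path_at nu v) (alpha_of nu').

(* The basis of the direct sum of all the summands of the complex. *)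
Definition generator : finType :=
  {nu : vstate G & monomial (alpha_of nu)}.

Definition hatC : vectType F := free_space F generator.

Definition hatC_deg (i : nat) : {vspace hatC} :=
  <<[seq basis_vector F x | x <- enum generator & weight (tag x) == i]>>%VS.

(* At most one term of the sum is present. *)
Definition hat_delta_coef (x y : generator) : F :=
  \sum_(v | ~~ tag x v && (tag y == raise (tag x) v))
    (-1) ^+ ones_before (tag x) v *
    (hat_delta_at (tag x) v (tag y) (basis_vector F (tagged x)) : hatA _)
      (tagged y).

Definition hat_delta : 'End(hatC) := linear_of hat_delta_coef.

(* Cycles modulo boundaries in degree [i], realized as a complement of the
   boundaries in the cycles. *)
Definition VCH (i : nat) : {vspace hatC} :=
  ((hatC_deg i :&: lker hat_delta) :\: (hatC_deg i :&: limg hat_delta))%VS.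

Definition euler_VCH : int :=
  \sum_(0 <= i < #|vertex G|.+1) (-1) ^+ i * (\dim (VCH i))%:Z.

End Homology.

(* Main.v *)
(* In the basis 1 + x, 1 - x of F[x]/(x^2 - 1) the tensor power over the circles
   of a state is spanned by the 2-colorings of its circles.  Once every circle
   of color s is rescaled by kappa s = (-1)^s sqrt 2, the map of a half-twist at
   [h] multiplies a coloring by kappa of the color of [h] if both sides of [h]
   have the same color and kills it otherwise, irrespective of what happens to
   the circles.  Hence the differential squares to zero and the Euler
   characteristic is the state sum of (-1)^|nu| 2^(number of circles).

   Writing 2^(number of circles) as a number of 2-colorings x of the sides of
   the half-edges and summing over nu first, the state sum becomes a sum over x
   of products of local weights.  These vanish unless the edges d whose two
   sides differ form an even subgraph, and on the sphere d is then the set of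
   edges separating the two colors of a 2-coloring g of the faces.  Replacing x
   by z + g, where z is a function on the edges, and expanding the local weights
   in the characters (-1)^(z y), the sum over z forces y to be a function on the
   edges, and the weight of (d, y) becomes the indicator of the 3-edge-colorings
   with colors (d, y) in F_2^2 - 0. *)
Require Import Defs.
From mathcomp Require Import all_boot all_order all_fingroup all_algebra reals complex ring zify.

Set Implicit Arguments.
Unset Strict Implicit.
Unset Printing Implicit Defensive.

Import Defs GRing.Theory Num.Theory.
Local Open Scope ring_scope.

(** * Classes of a symmetric relation *)

Section Classes.
Variables (T : finType) (e : rel T).
Hypothesis e_sym : symmetric e.

Definition classes_of : {set {set T}} :=
  equivalence_partition (connect e) [set: T].

Definition locally_constant (p : T -> bool) : bool :=
  [forall x, forall y, e x y ==> (p x == p y)].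

Lemma locally_constantP (p : T -> bool) :
  reflect (forall x y, e x y -> p x = p y) (locally_constant p).
Proof.
apply: (iffP forallP) => [H x y exy | H x].
  by have /forallP/(_ y)/implyP/(_ exy)/eqP := H x.
by apply/forallP => y; apply/implyP => /H ->.
Qed.

Lemma locally_constant_connect (p : T -> bool) x y :
  locally_constant p -> connect e x y -> p x = p y.
Proof.
move/locally_constantP=> Hp /connectP[s].
elim: s x => [|z s IH] x /=; first by move=> _ ->.
by case/andP=> /Hp -> /IH.
Qed.

Lemma connect_equivalence_rel :
  {in [set: T] & &, equivalence_rel (connect e)}.
Proof.
move=> x y z _ _ _; split; first exact: connect0.
by move=> cxy; exact: (same_connect (sym_connect_sym e_sym)).
Qed.

Lemma classes_of_partition : partition classes_of [set: T].
Proof. exact: equivalence_partitionP connect_equivalence_rel. Qed.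

Lemma pblock_classes_ofE x y : (y \in pblock classes_of x) = connect e x y.
Proof. exact: (pblock_equivalence_partition connect_equivalence_rel). Qed.

Lemma pblock_classes_of x : pblock classes_of x \in classes_of.
Proof.
by rewrite pblock_mem // (cover_partition classes_of_partition) inE.
Qed.

Lemma mem_classE (A : {set T}) x y :
  A \in classes_of -> x \in A -> (y \in A) = connect e x y.
Proof.
move=> AD xA; case/and3P: classes_of_partition => _ tI _.
by rewrite -(def_pblock tI AD xA) pblock_classes_ofE.
Qed.

Lemma class_neq0 (A : {set T}) : A \in classes_of -> exists x, x \in A.
Proof.
move=> AD; apply/set0Pn; apply: contraTneq AD => ->.
by case/and3P: classes_of_partition.
Qed.

Lemma class_eq (A B : {set T}) x :
  A \in classes_of -> B \in classes_of -> x \in A -> x \in B -> A = B.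
Proof.
by move=> AD BD xA xB; apply/setP => y; rewrite (mem_classE y AD xA) (mem_classE y BD xB).
Qed.

Lemma class_closed (A : {set T}) x y :
  A \in classes_of -> e x y -> (x \in A) = (y \in A).
Proof.
move=> AD exy; have cxy := connect1 exy.
by apply/idP/idP => H; rewrite (mem_classE _ AD H) // (sym_connect_sym e_sym).
Qed.

Lemma classE (A : {set T}) x :
  x \in A -> (forall y, (y \in A) = connect e x y) -> A \in classes_of.
Proof.
move=> xA HA; suff -> : A = pblock classes_of x by exact: pblock_classes_of.
by apply/setP => y; rewrite pblock_classes_ofE HA.
Qed.

Definition class := {A : {set T} | A \in classes_of}.
Definition class_of (x : T) : class :=
  exist (fun A => A \in classes_of) _ (pblock_classes_of x).

(** The common value of a locally constant [p] on [A]; the existential form needs no chosen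
    representative and makes sense for any set. *)
Definition class_value (p : T -> bool) (A : {set T}) : bool :=
  [exists x in A, p x].

Lemma class_valueE (p : T -> bool) (A : {set T}) x :
  locally_constant p -> A \in classes_of -> x \in A -> class_value p A = p x.
Proof.
move=> Hp AD xA; apply/existsP/idP => [[y /andP[yA py]]|px]; last first.
  by exists x; rewrite xA.
by rewrite (locally_constant_connect Hp (_ : connect e x y)) // -(mem_classE _ AD xA).
Qed.

Lemma mem_class_of x : x \in val (class_of x).
Proof. by rewrite /= pblock_classes_ofE. Qed.

Lemma class_ofE (A : class) x : x \in val A -> class_of x = A.
Proof.
move=> xA; apply: val_inj; apply: class_eq xA => //; last exact: mem_class_of.
  exact: valP.
exact: valP.
Qed.

Lemma locally_constant_class_of (q : class -> bool) :
  locally_constant (fun x => q (class_of x)).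
Proof.
apply/locally_constantP => x y exy; congr q; apply: class_ofE.
by rewrite (class_closed (valP (class_of y)) exy) mem_class_of.
Qed.

Lemma card_locally_constant :
  #|[set p : {ffun T -> bool} | locally_constant p]| = (2 ^ #|classes_of|)%N.
Proof.
pose f (q : {ffun class -> bool}) : {ffun T -> bool} := [ffun x => q (class_of x)].
have f_inj : injective f.
  move=> q q' /ffunP E; apply/ffunP => A; have [x xA] := class_neq0 (valP A).
  by have := E x; rewrite !ffunE (class_ofE xA).
rewrite -[in RHS]card_sig -card_bool -card_ffun -(card_imset _ f_inj).
apply: eq_card => p; rewrite inE; apply/idP/imsetP => [Hp | [q _ ->]].
  exists [ffun A => class_value p (val A)] => //; apply/ffunP => x; rewrite !ffunE.
  by rewrite (class_valueE Hp (valP (class_of x)) (mem_class_of x)).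
apply/locally_constantP => x y exy; rewrite !ffunE.
exact: (locally_constantP _ (locally_constant_class_of q)).
Qed.

End Classes.

(** A path that starts in [A] stays in [A], hence avoids [B], and off [B] the two relations have the
    same steps. *)
Lemma class_avoiding (T : finType) (e1 e2 : rel T) (B A : {set T}) :
  symmetric e1 -> symmetric e2 ->
  (forall x, x \notin B -> e1 x =1 e2 x) ->
  A \in classes_of e1 -> [disjoint A & B] -> A \in classes_of e2.
Proof.
move=> s1 s2 E AD dAB; have [x xA] := class_neq0 s1 AD.
have nB y : y \in A -> y \notin B by move=> yA; rewrite (disjointFr dAB yA).
apply: (classE s2 xA) => y; rewrite (mem_classE s1 y AD xA).
have step z : z \in A -> e1 z =1 e2 z by move/nB/E.
have clos z t : z \in A -> e1 z t -> t \in A.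
  by move=> zA ezt; rewrite -(class_closed s1 AD ezt).
apply/connectP/connectP => -[p pp ->]; exists p => //;
  elim: p x xA pp {y} => //= z p IH x xA /andP[exz pz].
  by rewrite -step // exz IH // (clos x).
by move: exz; rewrite -step // => exz; rewrite exz IH // (clos x).
Qed.

Lemma even_fixfree (T : finType) (A : {set T}) (f : T -> T) :
  (forall x, x \in A -> [/\ f x \in A, f (f x) = x & f x != x]) -> ~~ odd #|A|.
Proof.
have [n] := ubnP #|A|; elim: n A => // n IH A ltA H.
have [->|/set0Pn[x xA]] := eqVneq A set0; first by rewrite cards0.
have [fA ffx nfx] := H x xA.
have E : #|A| = #|A :\ x :\ f x|.+2.
  by rewrite (cardsD1 x) xA (cardsD1 (f x) (A :\ x)) !inE nfx fA.
rewrite E /= negbK; apply: IH; first by rewrite -ltnS -E ltnW.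
move=> y; rewrite !inE => /and3P[yfx yx yA]; have [fy ffy nfy] := H y yA.
split => //; rewrite fy andbT; apply/andP; split; apply/eqP => Ey.
  by move/eqP: yx; apply; rewrite -ffy Ey ffx.
by move/eqP: yfx; apply; rewrite -ffy Ey.
Qed.

(** * Half-edges and boundary circles of trivalent ribbon graphs *)

Section Corners.
Variables (G : multigraph) (Gamma : ribbon_graph G).
Hypothesis G_trivalent : trivalent G.
Implicit Types (v : vertex G) (h : half_edge G).

Lemma exists_half v : exists h, endpoint h == v.
Proof.
have : half_edges_at v != set0 by rewrite -card_gt0 G_trivalent.
by case/set0Pn => h; rewrite inE; exists h.
Qed.

Definition half1 v : half_edge G := xchoose (exists_half v).
Definition half2 v : half_edge G := rot Gamma (half1 v).
Definition half3 v : half_edge G := rot Gamma (half2 v).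

Lemma endpoint_rot h : endpoint (rot Gamma h) = endpoint h.
Proof.
have := mem_porbit (rot Gamma) 1 h.
by rewrite (rotP Gamma) inE expg1 => /eqP.
Qed.

Lemma endpoint_half1 v : endpoint (half1 v) = v.
Proof. exact/eqP/(xchooseP (exists_half v)). Qed.

Lemma endpoint_half2 v : endpoint (half2 v) = v.
Proof. by rewrite endpoint_rot endpoint_half1. Qed.

Lemma endpoint_half3 v : endpoint (half3 v) = v.
Proof. by rewrite endpoint_rot endpoint_half2. Qed.

Lemma card_porbit_rot h : #|porbit (rot Gamma) h| = 3%N.
Proof. by rewrite (rotP Gamma) G_trivalent. Qed.

Lemma rot_half3 v : rot Gamma (half3 v) = half1 v.
Proof. by have := iter_porbit (rot Gamma) (half1 v); rewrite card_porbit_rot. Qed.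

Lemma mem_halves v h :
  (endpoint h == v) = (h \in [:: half1 v; half2 v; half3 v]).
Proof.
have := porbit_traject (rot Gamma) (half1 v) h.
by rewrite card_porbit_rot (rotP Gamma) inE endpoint_half1.
Qed.

Lemma halves_uniq v : uniq [:: half1 v; half2 v; half3 v].
Proof.
by have := uniq_traject_porbit (rot Gamma) (half1 v); rewrite card_porbit_rot.
Qed.

Lemma prod_half_edges_at (S : comPzRingType) v (F : half_edge G -> S) :
  \prod_(h | endpoint h == v) F h = F (half1 v) * (F (half2 v) * F (half3 v)).
Proof.
rewrite (eq_bigl _ _ (mem_halves v)) -big_uniq ?halves_uniq //=.
by rewrite !big_cons big_nil mulr1.
Qed.

Lemma prod_half_edges (S : comPzRingType) (F : half_edge G -> S) :
  \prod_h F h = \prod_v (F (half1 v) * (F (half2 v) * F (half3 v))).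
Proof.
rewrite (partition_big (@endpoint G) predT) //=.
by apply: eq_bigr => v _; rewrite prod_half_edges_at.
Qed.

Lemma forall_half_edges (P : pred (half_edge G)) :
  [forall h, P h] = [forall v, [&& P (half1 v), P (half2 v) & P (half3 v)]].
Proof.
apply/forallP/forallP => [HP v | HP h]; first by rewrite !HP.
have /and3P[P1 P2 P3] := HP (endpoint h).
have := mem_halves (endpoint h) h; rewrite eqxx !inE.
by case/esym/or3P => /eqP ->.
Qed.

Lemma prod_bands (S : comPzRingType) (F : half_edge G -> S) :
  \prod_h F h = \prod_e (F (e, false) * F (e, true)).
Proof.
have -> : \prod_h F h = \prod_e \prod_b F (e, b).
  by rewrite pair_bigA; apply: eq_bigr => -[].
by apply: eq_bigr => e _; rewrite big_bool mulrC.
Qed.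

Lemma forall_bands (P : pred (half_edge G)) :
  [forall h, P h] = [forall e, P (e, false) && P (e, true)].
Proof.
apply/forallP/forallP => [HP e | HP [e b]]; first by rewrite !HP.
by case: b (HP e) => /andP[].
Qed.

(** Each half-edge is exactly one of [half1], [half2], [half3] at its endpoint, so a function on
    half-edges is a family of triples of bits indexed by the vertices, and the product of sums
    distributes. *)
Lemma sum_local (S : comPzRingType) (F : vertex G -> bool -> bool -> bool -> S) :
  \sum_(y : {ffun half_edge G -> bool})
     \prod_v F v (y (half1 v)) (y (half2 v)) (y (half3 v))
  = \prod_v \sum_(t : bool * bool * bool) F v t.1.1 t.1.2 t.2.
Proof.
rewrite bigA_distr_bigA /=.
pose f (y : {ffun half_edge G -> bool}) : {ffun vertex G -> bool * bool * bool} :=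
  [ffun v => (y (half1 v), y (half2 v), y (half3 v))].
pose g (Y : {ffun vertex G -> bool * bool * bool}) : {ffun half_edge G -> bool} :=
  [ffun h => if h == half1 (endpoint h) then (Y (endpoint h)).1.1
             else if h == half2 (endpoint h) then (Y (endpoint h)).1.2
             else (Y (endpoint h)).2].
rewrite (reindex f) /=; last first.
  exists g => [y _ | Y _].
    apply/ffunP => h; rewrite !ffunE.
    have := mem_halves (endpoint h) h; rewrite eqxx !inE.
    case: eqP => [<- //|_]; case: eqP => [<- //|_] /=.
    by move/esym/eqP=> <-.
  apply/ffunP => v; rewrite !ffunE.
  rewrite endpoint_half1 endpoint_half2 endpoint_half3 eqxx.
  have := halves_uniq v; rewrite /= !inE negb_or -andbA => /and4P[n12 n13 n23 _].
  rewrite eq_sym (negbTE n12) eqxx eq_sym (negbTE n13) eq_sym (negbTE n23).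
  by case: (Y v) => [[]].
by apply: eq_bigr => y _; apply: eq_bigr => v _; rewrite ffunE.
Qed.

End Corners.

(** * Boundary circles and colorings of half-edges *)

Section Boundaries.
Variables (G : multigraph).
Implicit Types (Gamma : ribbon_graph G) (h : half_edge G).

Lemma other_halfK : involutive (@other_half G).
Proof. by case=> e b; rewrite /other_half /= negbK. Qed.

Lemma other_half_neq h : other_half h != h.
Proof. by case: h => e b; rewrite /other_half xpair_eqE eqxx /=; case: b. Qed.

Lemma badj_sym Gamma : symmetric (badj Gamma).
Proof.
move=> [[h s]|[[c s]|v]] [[h' s']|[[c' s']|v']] //=.
  have -> : (h' == other_half h) = (h == other_half h').
    by apply/eqP/eqP => ->; rewrite other_halfK.
  have -> : (h == other_half h') && (s' == s (+) ~~ twist Gamma h.1)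
          = (h == other_half h') && (s == s' (+) ~~ twist Gamma h'.1).
    by case: eqP => // -> /=; case: s; case: s'; case: (twist _ _).
  rewrite orbCA [s' && _]andbC [~~ s' && _]andbC -!andbA.
  by case: s; case: s'; rewrite ?andbF ?andbT.
by rewrite eq_sym; case: eqP => // -> /=; case: s; case: s'; case: (loop_twist _ _).
Qed.

Lemma other_halfE (g h : half_edge G) : g.1 = h.1 -> g != h -> g = other_half h.
Proof.
case: g h => e b [e' b'] /= ->; rewrite /other_half xpair_eqE eqxx /=.
by case: b; case: b'.
Qed.

(* The marked point on the side [tau v] of [h] records [x h], the other side
   of [h] then being the side recorded by the other half of the band. *)
Definition arc_ok Gamma (t : bool) (x : half_edge G -> bool) h : bool :=
  if t then x h == x (other_half (rot Gamma h))
  else x (other_half h) == x (rot Gamma h).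

(** Reading the sides with respect to the local orientations [tau] removes all twists: the band
    condition is built into recording each side by one half-edge, and only the arc condition at each
    corner remains. *)
Lemma card_boundary Gamma (tau : vertex G -> bool) :
  trivalent G -> (loop G -> False) ->
  (forall e, twist Gamma e =
     tau (endpoint (e, false)) (+) tau (endpoint (e, true))) ->
  (2 ^ #|boundary Gamma|)%N =
  #|[set x : {ffun half_edge G -> bool} |
      [forall h, arc_ok Gamma (tau (endpoint h)) x h]]|.
Proof.
move=> tri noloop twE; rewrite -(card_locally_constant (badj_sym Gamma)).
pose f (x : {ffun half_edge G -> bool}) : {ffun bpoint G -> bool} :=
  [ffun q => match q with
    | inl (h, s) => if s == tau (endpoint h) then x h else x (other_half h)
    | inr _ => false end].
have f_inj : injective f.
  move=> x y /ffunP E; apply/ffunP => h.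
  by have := E (inl (h, tau (endpoint h))); rewrite !ffunE eqxx.
have twH h : twist Gamma h.1 = tau (endpoint h) (+) tau (endpoint (other_half h)).
  by rewrite twE; case: h => e []; rewrite /other_half //= addbC.
have noiso (v : {v : vertex G | half_edges_at v == set0}) : False.
  by case: v => v /eqP v0; have := tri v; rewrite v0 cards0.
rewrite -(card_imset _ f_inj); apply: eq_card => p; rewrite inE.
apply/idP/imsetP => [/locally_constantP Hp | [x]].
  have pband h s : p (inl (h, s)) = p (inl (other_half h, s (+) ~~ twist Gamma h.1)).
    by apply: Hp; rewrite /= !eqxx !orbT.
  have parc h : p (inl (h, true)) = p (inl (rot Gamma h, false)).
    by apply: Hp; rewrite /= eqxx.
  have E h s : p (inl (h, s)) = if s == tau (endpoint h) then p (inl (h, tau (endpoint h)))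
      else p (inl (other_half h, tau (endpoint (other_half h)))).
    case: eqP => [->//|ns]; rewrite pband twH; congr (p (inl (_, _))).
    by move: ns; case: s; case: (tau (endpoint h)); case: (tau _).
  exists [ffun h => p (inl (h, tau (endpoint h)))].
    rewrite inE; apply/forallP => h; rewrite /arc_ok !ffunE.
    have := parc h; rewrite (E h) (E (rot Gamma h)) endpoint_rot.
    by case: (tau (endpoint h)) => /= ->; rewrite ?endpoint_rot.
  apply/ffunP => -[[h s]|[[c ?]|v]]; rewrite !ffunE; first by rewrite -E.
    by case: (noloop c).
  by case: (noiso v).
rewrite inE => /forallP Hx ->; apply/locally_constantP.
have arc h : f x (inl (h, true)) = f x (inl (rot Gamma h, false)).
  have := Hx h; rewrite /arc_ok !ffunE endpoint_rot.
  by case: (tau (endpoint h)) => /= /eqP.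
move=> [[h s]|[[c s]|v]] [[h' s']|[[c' s']|v']] /=; try discriminate.
  2: by case: (noloop c).
case/or3P.
- by case/and3P=> -> /negbTE-> /eqP->.
- by case/and3P=> /negbTE-> -> /eqP->.
case/andP => /eqP -> /eqP ->; rewrite !ffunE other_halfK twH.
by case: s; case: (tau (endpoint h)); case: (tau _).
Qed.

End Boundaries.

(** * The state sum of a plane trivalent graph *)

Lemma natr_forall (S : comPzRingType) (I : finType) (P : pred I) :
  [forall i, P i]%:R = \prod_i (P i)%:R :> S.
Proof.
case: forallP => [HP | /forallP]; first by rewrite big1 // => i _; rewrite HP.
by rewrite negb_forall => /existsP[i /negbTE Pi]; rewrite (bigD1 i) //= Pi mul0r.
Qed.

Lemma card_sum_natr (I : finType) (P : pred I) :
  #|[set i | P i]|%:Z = \sum_i (P i)%:R.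
Proof.
rewrite -natz -sum1_card big_mkcond natr_sum; apply: eq_bigr => i _.
by rewrite inE; case: (P i).
Qed.

Lemma sign_sum (S : comPzRingType) (a b : bool) :
  \sum_(t : bool) ((-1) ^+ (t && a) * (-1) ^+ (t && b)) = 2 * (a == b)%:R :> S.
Proof.
by rewrite big_bool; case: a; case: b;
  rewrite /= ?expr0 ?expr1 ?mulr1 ?mul1r ?mulrNN ?mulr1 ?mulr0 ?addNr.
Qed.

(* The colors are the nonzero pairs (d, y) of bits. *)
Definition edge_proper3 (d1 d2 d3 y1 y2 y3 : bool) : bool :=
  [&& d1 || y1, d2 || y2, d3 || y3, (d1, y1) != (d2, y2),
      (d1, y1) != (d3, y3) & (d2, y2) != (d3, y3)].

(** * Local weights at a vertex *)

Section CornerSums.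
Variables (G : multigraph) (Gamma : ribbon_graph G).
Hypothesis tri : trivalent G.
Hypothesis noloop : loop G -> False.
Variable o : vertex G -> bool.
Hypothesis oE : forall e, twist Gamma e =
  o (endpoint (e, false)) (+) o (endpoint (e, true)).

Let h1 := half1 tri.
Let h2 := half2 Gamma tri.
Let h3 := half3 Gamma tri.

(** The bit [b] tells whether [v] is raised: a half-twist at each of the three half-edges of [v]
    amounts to flipping the orientation [o v] of its disc. *)
Definition corner_sum v (x : half_edge G -> bool) : int :=
  \sum_(b : bool) (-1) ^+ b *
    ([&& arc_ok Gamma (o v (+) b) x (h1 v), arc_ok Gamma (o v (+) b) x (h2 v) &
         arc_ok Gamma (o v (+) b) x (h3 v)])%:R.

Lemma state_sum :
  \sum_(nu : vstate G) (-1) ^+ weight nu *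
     (2 ^ #|boundary (add_twists Gamma (alpha_of nu))|)%N%:Z
  = \sum_(x : {ffun half_edge G -> bool}) \prod_v corner_sum v x.
Proof.
have E (nu : vstate G) : (-1) ^+ weight nu *
     (2 ^ #|boundary (add_twists Gamma (alpha_of nu))|)%N%:Z =
   \sum_(x : {ffun half_edge G -> bool}) \prod_v ((-1) ^+ nu v *
    ([&& arc_ok Gamma (o v (+) nu v) x (h1 v), arc_ok Gamma (o v (+) nu v) x (h2 v) &
         arc_ok Gamma (o v (+) nu v) x (h3 v)])%:R) :> int.
  (* After the twists of [nu], the orientations [o v (+) nu v] make every band untwisted. *)
  rewrite (@card_boundary _ _ (fun v => o v (+) nu v)) //; last first.
    by move=> e; rewrite !ffunE oE; case: (o _); case: (o _); case: (nu _); case: (nu _).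
  rewrite card_sum_natr mulr_sumr; apply: eq_bigr => x _; rewrite big_split /=; congr (_ * _).
    rewrite -(big_morph _ (exprD _) (expr0 _)) /weight -sum1_card big_mkcond /=.
    by congr (_ ^+ _); apply: eq_bigr => v _; rewrite inE; case: (nu v).
  rewrite (forall_half_edges Gamma tri) natr_forall; apply: eq_bigr => v _.
  by rewrite endpoint_half1 endpoint_half2 endpoint_half3.
rewrite (eq_bigr _ (fun nu _ => E nu)) exchange_big /=; apply: eq_bigr => x _.
by rewrite bigA_distr_bigA.
Qed.

Lemma arc_okE t x v :
  [&& arc_ok Gamma t x (h1 v), arc_ok Gamma t x (h2 v) & arc_ok Gamma t x (h3 v)] =
  if t then [&& x (h1 v) == x (other_half (h2 v)), x (h2 v) == x (other_half (h3 v))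
             & x (h3 v) == x (other_half (h1 v))]
  else [&& x (other_half (h1 v)) == x (h2 v), x (other_half (h2 v)) == x (h3 v)
             & x (other_half (h3 v)) == x (h1 v)].
Proof.
rewrite /arc_ok -/(half2 Gamma tri v) -/(half3 Gamma tri v) /h3 rot_half3.
by case: t.
Qed.

(** For each of the two orientations, the three corner equations add up to the vanishing of the sum
    of the three [d]; so both terms are 0 when this sum is odd. *)
Lemma corner_sum_eq0 v x (d : band G -> bool) :
  (forall h, x (other_half h) = x h (+) d h.1) ->
  d (h1 v).1 (+) d (h2 v).1 (+) d (h3 v).1 -> corner_sum v x = 0.
Proof.
move=> xd; rewrite /corner_sum big_bool !arc_okE !xd.
move: (d _) (d _) (d _) (x _) (x _) (x _) => d1 d2 d3 x1 x2 x3.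
by case: (o v); case: d1; case: d2; case: d3 => //; case: x1; case: x2; case: x3.
Qed.

(** As [g] satisfies the conditions of the unflipped disc, either all [d] vanish at [v], or exactly
    two are 1, say the first two. In the first case both sides are 0. In the second the unflipped
    disc asks for z1 = z2 = z3 and the flipped one for z1 = z2 <> z3, so twice the weight is (-1)^z3
    ((-1)^z1 + (-1)^z2), which is the sum over the two proper [t]. *)
Lemma corner_sumE v (x g : half_edge G -> bool) (z d : band G -> bool) :
  (forall h, x h = z h.1 (+) g h) ->
  (forall h, g (other_half h) = g h (+) d h.1) ->
  [&& arc_ok Gamma (o v) g (h1 v), arc_ok Gamma (o v) g (h2 v)
    & arc_ok Gamma (o v) g (h3 v)] ->
  2 * corner_sum v x = \sum_(t : bool * bool * bool)
    (edge_proper3 (d (h1 v).1) (d (h2 v).1) (d (h3 v).1) t.1.1 t.1.2 t.2)%:R *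
    ((-1) ^+ (z (h1 v).1 && t.1.1) * ((-1) ^+ (z (h2 v).1 && t.1.2) *
     (-1) ^+ (z (h3 v).1 && t.2))).
Proof.
move=> xE gd; rewrite /corner_sum big_bool !arc_okE !xE /= !gd.
have -> (F : bool * bool * bool -> int) : \sum_t F t =
  \sum_(a : bool) \sum_(b : bool) \sum_(c : bool) F (a, b, c).
  by rewrite !pair_bigA /=; apply: eq_bigr => -[[]].
rewrite !big_bool /=.
move: (d _) (d _) (d _) (g _) (g _) (g _) (z _) (z _) (z _).
move=> d1 d2 d3 g1 g2 g3 z1 z2 z3.
by case: (o v); case: d1; case: d2; case: d3; case: g1; case: g2; case: g3 => //= _;
  case: z1; case: z2; case: z3; vm_compute.
Qed.

End CornerSums.

(** * Even subgraphs and face colorings on the sphere *)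

Section FaceFunctions.
Variables (G : multigraph) (Gamma : ribbon_graph G).
Hypothesis tri : trivalent G.
Hypothesis noloop : loop G -> False.
Variable o : vertex G -> bool.
Hypothesis oE : forall e, twist Gamma e =
  o (endpoint (e, false)) (+) o (endpoint (e, true)).
Hypothesis conn : forall v w : vertex G, connect (@adjacent G) (inl v) (inl w).
Hypothesis vertex_gt0 : (0 < #|vertex G|)%N.
Hypothesis euler : capped_euler Gamma = 2.

Implicit Types (g : {ffun half_edge G -> bool}) (h : half_edge G).
Implicit Types (d : {ffun band G -> bool}).
Let h1 := half1 tri.
Let h2 := half2 Gamma tri.
Let h3 := half3 Gamma tri.

Definition edge_cycle (d : {ffun band G -> bool}) : bool :=
  [forall v, ~~ (d (h1 v).1 (+) d (h2 v).1 (+) d (h3 v).1)].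

(** By [card_boundary] these encode the 2-colorings of the faces: [g h] is the color of the face
    along the side [o (endpoint h)] of [h]. *)
Definition face_fun (g : {ffun half_edge G -> bool}) : bool :=
  [forall h, arc_ok Gamma (o (endpoint h)) g h].

(** For a face coloring, the set of edges whose two sides have different colors. *)
Definition jump (g : {ffun half_edge G -> bool}) : {ffun band G -> bool} :=
  [ffun e => g (e, false) (+) g (e, true)].

Lemma jumpE (g : {ffun half_edge G -> bool}) (h : half_edge G) :
  g (other_half h) = g h (+) jump g h.1.
Proof.
by rewrite ffunE; case: h => e []; rewrite /other_half /=; case: (g _); case: (g _).
Qed.

Lemma constant_connected (p : vertex G -> bool) v w :
  (forall h, p (endpoint h) = p (endpoint (other_half h))) -> p v = p w.
Proof.
move=> Hp; case/connectP: (conn v w) => s.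
elim: s v => [|[u|//] s IH] v /=; first by move=> _ [->].
by case/andP=> /existsP[h /andP[/eqP <- /eqP <-]] /IH H /H <-; rewrite Hp.
Qed.

(* Expand the parity condition at each vertex in characters of F_2. *)
Lemma card_edge_cycle :
  (#|[set d | edge_cycle d]| * 2 ^ #|vertex G| = 2 ^ #|band G| * 2)%N.
Proof.
apply/eqP; rewrite -eqz_nat PoszM card_sum_natr -!natz natrX mulr_suml.
have E (d : {ffun band G -> bool}) : (edge_cycle d)%:R * 2 ^+ #|vertex G| =
   \sum_(psi : {ffun vertex G -> bool}) \prod_h (-1) ^+ (psi (endpoint h) && d h.1) :> int.
  rewrite natr_forall -prodr_const -big_split /=.
  under [RHS]eq_bigr => psi _ do rewrite (prod_half_edges Gamma tri).
  transitivity (\prod_v \sum_(b : bool) (-1) ^+ (b && d (h1 v).1) *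
     ((-1) ^+ (b && d (h2 v).1) * (-1) ^+ (b && d (h3 v).1)) : int).
    by apply: eq_bigr => v _; rewrite big_bool /=; case: (d _); case: (d _); case: (d _).
  rewrite bigA_distr_bigA /=; apply: eq_bigr => psi _; apply: eq_bigr => v _.
  by rewrite endpoint_half1 endpoint_half2 endpoint_half3.
rewrite (eq_bigr _ (fun d _ => E d)) exchange_big /=.
(* Orthogonality in [d] keeps only the [psi] that are constant along every band; by connectedness
   these are the two constants. *)
have E2 (psi : {ffun vertex G -> bool}) :
   \sum_(d : {ffun band G -> bool}) \prod_h (-1) ^+ (psi (endpoint h) && d h.1) =
   2 ^+ #|band G| * [forall h, psi (endpoint h) == psi (endpoint (other_half h))]%:R :> int.
  rewrite forall_bands natr_forall -prodr_const -big_split /=.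
  under eq_bigr => d _ do rewrite prod_bands.
  rewrite -(bigA_distr_bigA (fun e b => (-1) ^+ (psi (endpoint (e, false)) && b) *
    (-1) ^+ (psi (endpoint (e, true)) && b))) /=; apply: eq_bigr => e _.
  under eq_bigr => b _ do rewrite ![_ && b]andbC.
  by rewrite sign_sum /other_half /= [in RHS]eq_sym andbb eq_sym.
rewrite (eq_bigr _ (fun psi _ => E2 psi)) -mulr_sumr natrM natrX; apply/eqP; congr (_ * _).
rewrite -card_sum_natr natz; congr (Posz _).
have /card_gt0P[v0 _] := vertex_gt0.
rewrite -card_bool.
rewrite -(card_imset predT (_ : injective (fun b : bool => [ffun _ : vertex G => b]))).
  apply: eq_card => psi; rewrite inE.
  apply/forallP/imsetP => [H | [b _ ->] h]; last by rewrite !ffunE.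
  exists (psi v0) => //; apply/ffunP => v; rewrite ffunE.
  by apply: constant_connected => h; apply/eqP.
by move=> b b' /ffunP/(_ v0); rewrite !ffunE.
Qed.

(** Going once around the disc of [v] returns to the initial color. *)
Lemma edge_cycle_jump g : face_fun g -> edge_cycle (jump g).
Proof.
move=> gF; apply/forallP => v; move: gF.
rewrite /face_fun (forall_half_edges Gamma tri) => /forallP/(_ v).
rewrite endpoint_half1 endpoint_half2 endpoint_half3 arc_okE !jumpE.
move: (jump g _) (jump g _) (jump g _) (g _) (g _) (g _) => d1 d2 d3 x1 x2 x3.
by case: (o v); case: d1; case: d2; case: d3 => //; case: x1; case: x2; case: x3.
Qed.

(** Equal jumps make the sum [k] of the two functions invariant across each band, the arc conditions
    make it invariant under [rot], and the graph is connected. *)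
Lemma face_fun_add g g' : face_fun g -> face_fun g' -> jump g = jump g' ->
  forall h h', g h (+) g' h = g h' (+) g' h'.
Proof.
move=> /forallP gF /forallP gF' /ffunP E.
pose k h := g h (+) g' h.
have ko h : k (other_half h) = k h.
  by rewrite /k !jumpE E; case: (g h); case: (g' h); case: (jump _ _).
have kr h : k (rot Gamma h) = k h.
  have := gF h; have := gF' h; rewrite /arc_ok; case: (o _) => /eqP E1 /eqP E2.
    by rewrite -[LHS]ko /k -E1 -E2.
  by rewrite -[RHS]ko /k -E1 -E2.
have kv h : k h = k (h1 (endpoint h)).
  have := mem_halves Gamma tri (endpoint h) h; rewrite eqxx !inE.
  by case/esym/or3P => /eqP ->;
    rewrite ?(endpoint_half1, endpoint_half2, endpoint_half3) /half3 /half2 ?kr.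
move=> h h'; rewrite -/(k h) -/(k h') kv [RHS]kv.
apply: (constant_connected (p := fun v => k (h1 v))) => {}h.
by rewrite -!kv ko.
Qed.

(* H_1 of the sphere vanishes: by Euler's formula there are exactly twice as
   many face functions as edge cycles, while the fibers of [jump] have at most
   two elements. *)
Lemma edge_cycle_ex_face d : edge_cycle d -> exists2 g, face_fun g & jump g = d.
Proof.
move=> dZ.
pose fib d := #|[set g | face_fun g & jump g == d]|.
have /card_gt0P[v0 _] := vertex_gt0.
have fib_le d' : (fib d' <= 2)%N.
  rewrite /fib -card_bool.
  have inj : {in [set g | face_fun g & jump g == d'] &,
    injective (fun g : {ffun half_edge G -> bool} => g (h1 v0))}.
    move=> g g'; rewrite !inE => /andP[gF /eqP gd] /andP[gF' /eqP gd'] E0.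
    apply/ffunP => h; have := face_fun_add gF gF' (etrans gd (esym gd')) h (h1 v0).
    by rewrite E0 addbb; case: (g h); case: (g' h).
  by rewrite -(card_in_imset inj) max_card.
have S : (\sum_(d' | edge_cycle d') fib d' = 2 * #|[set d' | edge_cycle d']|)%N.
  have -> : (\sum_(d' | edge_cycle d') fib d' = #|[set g | face_fun g]|)%N.
    rewrite -[RHS]sum1_card (partition_big jump edge_cycle) /=; last first.
      by move=> g; rewrite inE; apply: edge_cycle_jump.
    apply: eq_bigr => d' _; rewrite /fib -sum1_card.
    by apply: eq_bigl => g; rewrite !inE.
  rewrite -(card_boundary tri noloop oE).
  (* After multiplication by 2^V both sides are powers of 2, and V - E + F = 2 equates the exponents
     F + V and E + 2. *)
  apply/eqP; rewrite -(eqn_pmul2r (_ : 0 < 2 ^ #|vertex G|)%N) ?expn_gt0 //.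
  rewrite -mulnA card_edge_cycle -expnSr -expnS -expnD eqn_exp2l //.
  have : (#|boundary Gamma| + #|vertex G|)%:Z = #|band G|%:Z + 2.
    by rewrite -euler /capped_euler PoszD; ring.
  by case=> ->; rewrite addn2.
have : fib d = 2.
  apply/eqP; rewrite eqn_leq fib_le /= leqNgt; apply/negP => lt2.
  have : (\sum_(d' | edge_cycle d') fib d' < \sum_(d' | edge_cycle d') 2)%N.
    rewrite (bigD1 d) //= [X in (_ < X)%N](bigD1 d) //= -addSn leq_add //.
    exact: leq_sum.
  rewrite S sum_nat_const.
  have -> : #|edge_cycle| = #|[set d' | edge_cycle d']| by rewrite cardsE.
  by rewrite mulnC ltnn.
move=> E; have : (0 < fib d)%N by rewrite E.
by rewrite card_gt0 => /set0Pn[g]; rewrite inE => /andP[gF /eqP]; exists g.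
Qed.

End FaceFunctions.

(** * From the state sum to 3-edge-colorings *)

Section Colorings.
Variables (G : multigraph) (Gamma : ribbon_graph G).
Hypothesis tri : trivalent G.
Hypothesis noloop : loop G -> False.
Variable o : vertex G -> bool.
Hypothesis oE : forall e, twist Gamma e =
  o (endpoint (e, false)) (+) o (endpoint (e, true)).
Hypothesis conn : forall v w : vertex G, connect (@adjacent G) (inl v) (inl w).
Hypothesis vertex_gt0 : (0 < #|vertex G|)%N.
Hypothesis euler : capped_euler Gamma = 2.

Let h1 := half1 tri.
Let h2 := half2 Gamma tri.
Let h3 := half3 Gamma tri.

Definition proper_at (d : {ffun band G -> bool}) (y : half_edge G -> bool) v : bool :=
  edge_proper3 (d (h1 v).1) (d (h2 v).1) (d (h3 v).1) (y (h1 v)) (y (h2 v)) (y (h3 v)).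

(** If [d] is an even subgraph, some face coloring [g] has jump [d], and the [x] with this jump are
    the z + g; the power of 2 pays for the factor 2 of [corner_sumE] at each vertex. Otherwise both
    sides vanish because of a vertex where [d] is odd: on the right, three distinct nonzero colors
    always add up to 0 in F_2^2. *)
Lemma sum_jump (d : {ffun band G -> bool}) :
  2 ^+ #|vertex G| * \sum_(x : {ffun half_edge G -> bool} | jump x == d)
     \prod_v corner_sum Gamma tri o v x =
  \sum_(z : {ffun band G -> bool}) \sum_(y : {ffun half_edge G -> bool})
     [forall v, proper_at d y v]%:R * \prod_h (-1) ^+ (z h.1 && y h) :> int.
Proof.
transitivity (\sum_(z : {ffun band G -> bool})
  \prod_v \sum_(t : bool * bool * bool)
    (edge_proper3 (d (h1 v).1) (d (h2 v).1) (d (h3 v).1) t.1.1 t.1.2 t.2)%:R *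
    ((-1) ^+ (z (h1 v).1 && t.1.1) * ((-1) ^+ (z (h2 v).1 && t.1.2) *
     (-1) ^+ (z (h3 v).1 && t.2))) : int); last first.
  apply: eq_bigr => z _.
  rewrite -(sum_local Gamma tri (fun v a b c =>
    (edge_proper3 (d (h1 v).1) (d (h2 v).1) (d (h3 v).1) a b c)%:R *
    ((-1) ^+ (z (h1 v).1 && a) * ((-1) ^+ (z (h2 v).1 && b) *
     (-1) ^+ (z (h3 v).1 && c))))).
  apply: eq_bigr => y _; rewrite natr_forall (prod_half_edges Gamma tri) -big_split /=.
  by apply: eq_bigr.
have [dZ|] := boolP (edge_cycle Gamma tri d).
  have [g gF gd] := edge_cycle_ex_face noloop oE conn vertex_gt0 euler dZ.
  rewrite mulr_sumr (reindex (fun z : {ffun band G -> bool} =>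
     [ffun h => z h.1 (+) g h] : {ffun half_edge G -> bool})) /=; last first.
    exists (fun x => [ffun e => x (e, false) (+) g (e, false)]) => [z _ | x].
      by apply/ffunP => e; rewrite !ffunE /= -addbA addbb addbF.
    rewrite inE => /eqP xd; apply/ffunP => -[e b]; rewrite !ffunE /=; case: b.
      have /ffunP/(_ e) := xd; rewrite -gd !ffunE.
      by case: (x _); case: (x _); case: (g _); case: (g _).
    by rewrite -addbA addbb addbF.
  apply: eq_big => [z | z _].
    apply/eqP; rewrite -gd; apply/ffunP => e; rewrite !ffunE /=.
    by case: (z _); case: (g _); case: (g _).
  rewrite -prodr_const -big_split /=; apply: eq_bigr => v _.
  apply: (corner_sumE (g := g)); first by move=> h; rewrite ffunE.
    by move=> h; rewrite jumpE gd.
  move: gF; rewrite /face_fun (forall_half_edges Gamma tri) => /forallP/(_ v).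
  by rewrite endpoint_half1 endpoint_half2 endpoint_half3.
rewrite negb_forall => /existsP[v]; rewrite negbK => dv.
rewrite big1 ?mulr0 => [|x /eqP xd]; last first.
  rewrite (bigD1 v) //= (corner_sum_eq0 _ _ dv) ?mul0r // => h.
  by rewrite jumpE xd.
rewrite big1 // => z _; rewrite (bigD1 v) //= big1 ?mul0r // => -[[a b] c] _ /=.
move: dv; rewrite /edge_proper3 -/h1 -/h2 -/h3.
by case: (d _); case: (d _); case: (d _); case: a; case: b; case: c; rewrite //= !mul0r.
Qed.

(** The bijection of the three colors with the nonzero elements of F_2^2; [color_decode] gives the
    remaining pair (0, 0) a default color. *)
Definition color_code (c : 'I_3) : bool * bool := (nat_of_ord c != 0%N, nat_of_ord c != 1%N).
Definition color_decode (t : bool * bool) : 'I_3 :=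
  if t.1 then (if t.2 then inord 2 else inord 1) else ord0.

Lemma color_codeK : cancel color_code color_decode.
Proof.
move=> [m lt]; case: m lt => [|[|[|m]]] lt; last by [].
- by apply: val_inj.
- by apply: val_inj; rewrite /color_decode /= inordK.
- by apply: val_inj; rewrite /color_decode /= inordK.
Qed.

Lemma color_decodeK t : t.1 || t.2 -> color_code (color_decode t) = t.
Proof.
case: t => -[] -[] //= _; rewrite /color_code /color_decode /= ?inordK //.
Qed.

Lemma edge_coloring3E (c : {ffun edge G -> 'I_3}) :
  edge_coloring3 c = [forall v, [&& c (inl (h1 v).1) != c (inl (h2 v).1),
    c (inl (h1 v).1) != c (inl (h3 v).1) & c (inl (h2 v).1) != c (inl (h3 v).1)]].
Proof.
have u := halves_uniq Gamma tri.
apply/forallP/forallP => [H v | H h].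
  have K h h' : endpoint h = v -> endpoint h' = v -> h != h' -> c (inl h.1) != c (inl h'.1).
    by move=> E E' n; have /forallP/(_ h')/implyP := H h; apply; rewrite E E' eqxx.
  have := u v; rewrite /= !inE negb_or -andbA => /and4P[n12 n13 n23 _].
  by rewrite !K ?endpoint_half1 ?endpoint_half2 ?endpoint_half3.
apply/forallP => h'; apply/implyP => /andP[/eqP E].
have := mem_halves Gamma tri (endpoint h) h.
have := mem_halves Gamma tri (endpoint h) h'.
rewrite -E eqxx; move: {E}(endpoint h) => v; rewrite !inE.
have /and3P[n12 n13 n23] := H v; rewrite -/(h1 _) -/(h2 _) -/(h3 _).
case/esym/or3P => /eqP -> /esym/or3P[] /eqP ->; rewrite ?eqxx //.
all: by move=> _; first [assumption | rewrite eq_sym; assumption].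
Qed.

Lemma card_coloring : #|[set c : {ffun edge G -> 'I_3} | edge_coloring3 c]|%:Z =
  \sum_(d : {ffun band G -> bool}) \sum_(y : {ffun band G -> bool})
    [forall v, proper_at d (fun h => y h.1) v]%:R.
Proof.
rewrite pair_bigA /= -(card_sum_natr (fun p : {ffun band G -> bool} * {ffun band G -> bool} =>
   [forall v, proper_at p.1 (fun h => p.2 h.1) v])); congr (Posz _).
pose f (c : {ffun edge G -> 'I_3}) : {ffun band G -> bool} * {ffun band G -> bool} :=
  ([ffun e => (color_code (c (inl e))).1], [ffun e => (color_code (c (inl e))).2]).
have f_inj : injective f.
  move=> c c' /pair_eqP/andP[/eqP/ffunP E1 /eqP/ffunP E2].
  apply/ffunP => -[e | l]; last by case: (noloop l).
  apply: (can_inj color_codeK).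
  have := E1 e; have := E2 e; rewrite !ffunE => e2 e1.
  by rewrite [LHS]surjective_pairing e1 e2 -surjective_pairing.
have codeN0 (k : 'I_3) : (color_code k).1 || (color_code k).2 by case: k => [[|[]]].
rewrite -(card_imset _ f_inj); apply: eq_card => -[d y]; rewrite inE /=.
apply/imsetP/forallP => [[c] | H].
  rewrite inE edge_coloring3E => /forallP Hc [-> ->] v.
  have /and3P[n12 n13 n23] := Hc v.
  rewrite /proper_at /edge_proper3 !ffunE !codeN0.
  by rewrite -!/(color_code _) !(can_eq color_codeK) n12 n13.
(* Properness at the end [(e, false)] of the band excludes the pair (0, 0). *)
have yN0 e : d e || y e.
  have := H (endpoint (e, false)).
  have := mem_halves Gamma tri (endpoint (e, false)) (e, false).
  rewrite eqxx !inE => /esym/or3P M /and5P[a b c _ _].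
  by case: M => /eqP E; move: a b c; rewrite /h1 /h2 /h3 -E.
have K e : color_code (color_decode (d e, y e)) = (d e, y e).
  by rewrite color_decodeK /= ?yN0.
exists [ffun e => if e is inl b then color_decode (d b, y b) else ord0]; last first.
  by congr (_, _); apply/ffunP => e; rewrite !ffunE K.
rewrite inE edge_coloring3E; apply/forallP => v; rewrite !ffunE.
have := H v; rewrite /proper_at /edge_proper3 => /and5P[_ _ _ n12 /andP[n13 n23]].
by rewrite -!(inj_eq (can_inj color_codeK)) !K n12 n13.
Qed.

Lemma card_half_edges : (#|band G| * 2 = #|vertex G| * 3)%N.
Proof.
transitivity #|{: half_edge G}|; first by rewrite card_prod card_bool.
rewrite -sum1_card (partition_big (@endpoint G) predT) //=.
rewrite (eq_bigr (fun _ => 3%N)) ?sum_nat_const // => v _.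
by rewrite -(tri v) -sum1_card; apply: eq_bigl => h; rewrite inE.
Qed.

Lemma state_sum_coloring :
  \sum_(nu : vstate G) (-1) ^+ weight nu *
     (2 ^ #|boundary (add_twists Gamma (alpha_of nu))|)%N%:Z
  = (2 ^ (#|vertex G|./2) * #|[set c : {ffun edge G -> 'I_3} | edge_coloring3 c]|)%N%:Z.
Proof.
rewrite (state_sum tri noloop oE) (partition_big (@jump G) predT) //=.
apply: (@mulfI _ (2 ^+ #|vertex G|)); first by rewrite expf_neq0.
rewrite mulr_sumr (eq_bigr _ (fun d _ => sum_jump d)) PoszM card_coloring.
have Ed (d : {ffun band G -> bool}) :
  \sum_(z : {ffun band G -> bool}) \sum_(y : {ffun half_edge G -> bool})
     [forall v, proper_at d y v]%:R * \prod_h (-1) ^+ (z h.1 && y h) =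
  2 ^+ #|band G| * \sum_(y : {ffun band G -> bool})
    [forall v, proper_at d (fun h => y h.1) v]%:R :> int.
  rewrite exchange_big /=.
  (* Orthogonality in [z] forces both halves of each band to carry the same bit of [y] and
     contributes a factor 2 per band. *)
  have Ey (y : {ffun half_edge G -> bool}) : \sum_(z : {ffun band G -> bool})
      [forall v, proper_at d y v]%:R * \prod_h (-1) ^+ (z h.1 && y h) =
      2 ^+ #|band G| * (if [forall e, y (e, false) == y (e, true)] then
        [forall v, proper_at d y v]%:R else 0) :> int.
    rewrite -mulr_sumr; under eq_bigr => z _ do rewrite prod_bands.
    rewrite -(bigA_distr_bigA (fun e b => (-1) ^+ (b && y (e, false)) *
      (-1) ^+ (b && y (e, true)))) /=.
    under eq_bigr => e _ do rewrite sign_sum.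
    rewrite big_split /= prodr_const -natr_forall mulrCA; congr (_ * _).
    by case: ifP => _; rewrite ?mulr1 ?mulr0.
  rewrite (eq_bigr _ (fun y _ => Ey y)) -mulr_sumr -big_mkcond /=; congr (_ * _).
  rewrite (reindex (fun y : {ffun band G -> bool} => [ffun h => y h.1])) /=; last first.
    exists (fun y => [ffun e => y (e, false)]) => [y _ | y].
      by apply/ffunP => e; rewrite !ffunE.
    rewrite inE => /forallP Hy; apply/ffunP => -[e []]; rewrite !ffunE //=.
    by apply/eqP/Hy.
  apply: eq_big => [y | y _]; first by apply/forallP => e; rewrite !ffunE.
  by congr (nat_of_bool _)%:R; apply: eq_forallb => v; rewrite /proper_at !ffunE.
rewrite (eq_bigr _ (fun d _ => Ed d)) -mulr_sumr -natz natrX mulrA -exprD; congr (2 ^+ _ * _).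
(* Since 2E = 3V, V is even and E = V + V/2. *)
have := card_half_edges; have := odd_double_half #|vertex G|; rewrite -muln2.
move: (#|vertex G|./2) (odd _) => m b <-; move: #|band G| => E.
case: b; lia.
Qed.

End Colorings.

(** * Half-twisting one band *)

Section Flip.
Variables (G : multigraph) (Gamma : ribbon_graph G).
Hypothesis tri : trivalent G.
Hypothesis noloop : loop G -> False.
Implicit Types (alpha beta : state G) (h : half_edge G).

Notation G_ alpha := (add_twists Gamma alpha).

(** The exclusive or makes the relation symmetric in the two states, so each fact about adding a
    half-twist also serves for removing it. *)
Definition differ_at h alpha beta : Prop :=
  forall h', beta h' = alpha h' (+) (h' == h).

Lemma differ_at_sym h alpha beta : differ_at h alpha beta -> differ_at h beta alpha.
Proof. by move=> D h'; rewrite D -addbA addbb addbF. Qed.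

Definition bpt h s : bpoint G := inl (h, s).

Lemma bpointP (q : bpoint G) : exists h s, q = bpt h s.
Proof.
case: q => [[h s]|[[c s]|[v v0]]]; first by exists h, s.
  by case: (noloop c).
by have := tri v; rewrite (eqP v0) cards0.
Qed.

(** The four marked points whose neighbours depend on the twist of the band of [h]. *)
Definition on_band h : {set bpoint G} :=
  [set q | if q is inl (g, _) then g.1 == h.1 else false].

Lemma twist_differ h alpha beta e : differ_at h alpha beta ->
  twist (G_ beta) e = twist (G_ alpha) e (+) (e == h.1).
Proof.
move=> D; rewrite !ffunE !D -!addbA; congr (addb _ _).
case: h {D} => e' b; rewrite !xpair_eqE /=.
by case: eqP => //= _; case: b; case: (alpha _); case: (alpha _).
Qed.

Lemma badj_differ h alpha beta q : differ_at h alpha beta ->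
  q \notin on_band h -> badj (G_ alpha) q =1 badj (G_ beta) q.
Proof.
move=> D; rewrite inE; case: q => [[g s]|[[c s]|v]] // /negbTE ng.
by case=> [[g' s']|[[c' s']|v']] //; rewrite /badj (twist_differ _ D) ng addbF.
Qed.

Definition circ alpha (q : bpoint G) : circle (G_ alpha) :=
  class_of (badj_sym (G_ alpha)) q.

Lemma mem_circ alpha q : q \in val (circ alpha q).
Proof. exact: mem_class_of. Qed.

Lemma circE alpha q (c : circle (G_ alpha)) : q \in val c -> circ alpha q = c.
Proof. exact: class_ofE. Qed.

Lemma affectedE h alpha beta : differ_at h alpha beta ->
  affected Gamma alpha beta = [set circ alpha (bpt h false); circ alpha (bpt h true)].
Proof.
move=> D; apply/setP => c; rewrite !inE; apply/existsP/orP.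
  case=> g /andP[]; rewrite D; have [->|ng] := eqVneq g h; last by rewrite addbF eqxx.
  by move=> _ /existsP[[] /circE <-]; [right | left].
have Dh : alpha h != beta h by rewrite D eqxx; case: (alpha h).
by case=> /eqP ->; exists h; rewrite Dh; apply/existsP;
  [exists false | exists true]; apply: mem_circ.
Qed.

Lemma band_adj alpha h s :
  badj (G_ alpha) (bpt h s) (bpt (other_half h) (s (+) ~~ twist (G_ alpha) h.1)).
Proof. by rewrite /= !eqxx !orbT. Qed.

Lemma arc_adj alpha h :
  badj (G_ alpha) (bpt h true) (bpt (rot Gamma h) false).
Proof. by rewrite /= eqxx. Qed.

(** A circle that misses both sides of [h] also misses their continuations at the other end of the
    band. *)
Lemma unaffected_disjoint h alpha beta (c : circle (G_ alpha)) :
  differ_at h alpha beta -> c \notin affected Gamma alpha beta ->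
  [disjoint val c & on_band h].
Proof.
move=> D; rewrite (affectedE D) !inE negb_or => /andP[nf nt].
have nh s : bpt h s \notin val c.
  by case: s; apply/negP => /circE E; [move: nt | move: nf]; rewrite -E eqxx.
rewrite disjoint_sym disjoint_subset; apply/subsetP => q; rewrite !inE.
case: q => [[g s]|//] /eqP gh.
have [->//|ng] := eqVneq g h; first exact: nh.
rewrite (other_halfE gh ng); have := nh (s (+) ~~ twist (G_ alpha) h.1).
rewrite (class_closed (badj_sym _) (valP c) (band_adj alpha h _)).
by rewrite -addbA addbb addbF.
Qed.

Lemma unaffected_boundary h alpha beta (c : circle (G_ alpha)) :
  differ_at h alpha beta -> c \notin affected Gamma alpha beta ->
  val c \in boundary (G_ beta).
Proof.
move=> D nc.
apply: (@class_avoiding _ (badj (G_ alpha)) (badj (G_ beta)) (on_band h)).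
- exact: badj_sym.
- exact: badj_sym.
- by move=> q; apply: badj_differ.
- exact: (valP c).
exact: unaffected_disjoint nc.
Qed.

Lemma unaffected_unaffected h alpha beta
    (c : circle (G_ alpha)) (c' : circle (G_ beta)) :
  differ_at h alpha beta -> c \notin affected Gamma alpha beta ->
  val c' = val c -> c' \notin affected Gamma beta alpha.
Proof.
move=> D nc E; have dj := unaffected_disjoint D nc.
rewrite (affectedE (differ_at_sym D)) !inE.
apply/negP => /orP[] /eqP Ec; have := mem_circ beta; move/(_ (bpt h _)); rewrite -?Ec.
  by move/(_ false); rewrite -Ec E => /(disjointFr dj); rewrite inE /= eqxx.
by move/(_ true); rewrite -Ec E => /(disjointFr dj); rewrite inE /= eqxx.
Qed.

(** A marked point on a half-edge has two neighbours, one along an arc of the vertex disc and one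
    along a side of the band. [arc_map] and [band_map] are the two resulting involutions; only the
    second depends on the state. *)
Definition arc_map (q : bpoint G) : bpoint G :=
  match q with
  | inl (h, true) => bpt (rot Gamma h) false
  | inl (h, false) => bpt ((rot Gamma)^-1%g h) true
  | _ => q
  end.

Definition band_map alpha (q : bpoint G) : bpoint G :=
  match q with
  | inl (h, s) => bpt (other_half h) (s (+) ~~ twist (G_ alpha) h.1)
  | _ => q
  end.

Lemma arc_map_adj alpha q : badj (G_ alpha) q (arc_map q).
Proof.
have [h [[] ->]] := bpointP q; first exact: arc_adj.
by rewrite badj_sym /= permKV eqxx.
Qed.

Lemma band_map_adj alpha q : badj (G_ alpha) q (band_map alpha q).
Proof. by have [h [s ->]] := bpointP q; apply: band_adj. Qed.

Lemma arc_mapK : involutive arc_map.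
Proof. by case=> [[h []]|//] /=; rewrite ?permK ?permKV. Qed.

Lemma band_mapK alpha : involutive (band_map alpha).
Proof. by case=> [[h s]|//] /=; rewrite other_halfK -addbA addbb addbF. Qed.

(* Were the two sides of [h] on different circles both before and after the
   twist, the points lying on the circle of [h, false] in both states would be
   paired by the arcs, and all of them but [h, false] paired by the bands. *)
Lemma affected_join h alpha beta : differ_at h alpha beta ->
  circ alpha (bpt h false) = circ alpha (bpt h true) \/
  circ beta (bpt h false) = circ beta (bpt h true).
Proof.
move=> D; have [|n1] := eqVneq (circ alpha (bpt h false)) (circ alpha (bpt h true)).
  by left.
have [|n2] := eqVneq (circ beta (bpt h false)) (circ beta (bpt h true)).
  by right.
exfalso; set u := bpt h false; set w := bpt h true.
pose C1 := val (circ alpha u); pose C2 := val (circ beta u).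
have w1 : w \notin C1 by apply/negP => /circE E; rewrite -E eqxx in n1.
have w2 : w \notin C2 by apply/negP => /circE E; rewrite -E eqxx in n2.
have u1 : u \in C1 by exact: mem_circ.
have u2 : u \in C2 by exact: mem_circ.
have cl1 q q' : badj (G_ alpha) q q' -> (q \in C1) = (q' \in C1).
  by apply: class_closed; [exact: badj_sym | exact: valP].
have cl2 q q' : badj (G_ beta) q q' -> (q \in C2) = (q' \in C2).
  by apply: class_closed; [exact: badj_sym | exact: valP].
move: C1 C2 w1 w2 u1 u2 cl1 cl2 => C1 C2 w1 w2 u1 u2 cl1 cl2.
pose S := C1 :&: C2; have uS : u \in S by rewrite inE u1.
have evA : ~~ odd #|S|.
  apply: (@even_fixfree _ _ arc_map) => q; rewrite !inE => /andP[q1 q2].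
  rewrite -(cl1 _ _ (arc_map_adj alpha q)) -(cl2 _ _ (arc_map_adj beta q)) q1 q2.
  rewrite arc_mapK; split=> //.
  by have [g [[] ->]] := bpointP q; apply/eqP.
(* The far end of the band misses [S]: one of its points is joined to [w] in [alpha], the other one
   in [beta]. So [S] without [u] is off this band, and there the bands pair the points in the same
   way in both states. *)
have evB : ~~ odd #|S :\ u|.
  have nb s : bpt (other_half h) s \notin S.
    rewrite inE negb_and.
    have [E|/negbTE E] := boolP (s == true (+) ~~ twist (G_ alpha) h.1).
      by rewrite (eqP E) -(cl1 _ _ (band_adj alpha h true)) w1.
    apply/orP; right.
    have -> : s = true (+) ~~ twist (G_ beta) h.1.
      by move: E; rewrite (twist_differ _ D) eqxx; case: s; case: (twist _ _).
    by rewrite -(cl2 _ _ (band_adj beta h true)).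
  have nB q : q \in S :\ u -> q \notin on_band h.
    rewrite !inE => /and3P[qu q1 q2]; apply/negP.
    have [g [s E]] := bpointP q; rewrite E => /eqP gh.
    have [Eg|ng] := eqVneq g h.
      move: qu w1 q1; rewrite /u /w E Eg; case: s {E} => [_ /negP //|]; by rewrite eqxx.
    by have := nb s; rewrite inE -(other_halfE gh ng) -E q1 q2.
  apply: (@even_fixfree _ _ (band_map alpha)) => q qS.
  have nq := nB q qS; move: qS; rewrite !inE => /and3P[qu q1 q2].
  rewrite band_mapK -(cl1 _ _ (band_map_adj alpha q)) q1; split=> //.
    rewrite -(cl2 q) ?q2 ?andbT; last by rewrite -(badj_differ D nq) band_map_adj.
    apply: contra nq => /eqP E; rewrite -[q](band_mapK alpha) E.
    by rewrite inE /= eqxx.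
  have [g [s ->]] := bpointP q; apply/eqP => -[] /eqP.
  by rewrite -/(other_half g) (negbTE (other_half_neq g)).
by move: evA; rewrite (cardsD1 u) uS /= (negbTE evB).
Qed.

End Flip.

(** * The filtered 2-color complex in the color basis *)

Section Frobenius.
Variable F : numClosedFieldType.

(** The eigenvalue of eta on 1 + (-1)^s x. *)
Definition kappa (s : bool) : F := (-1) ^+ s * sqrtC 2.

Lemma sqr_kappa s : kappa s * kappa s = 2.
Proof. by rewrite mulrACA -!expr2 sqrtCK sqrr_sign mul1r. Qed.

Lemma kappa_neq0 s : kappa s != 0.
Proof. by apply/eqP => E; have /eqP := sqr_kappa s; rewrite E mul0r eq_sym pnatr_eq0. Qed.

Lemma sum_ord2 (f : 'I_2 -> F) : \sum_j f j = f ord0 + f ord_max.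
Proof.
by rewrite big_ord_recl big_ord1; congr (_ + f _); apply: val_inj.
Qed.

Lemma parity_charE (m n : nat) :
  (m == n %[mod 2])%N%:R = 2^-1 * \sum_(s : bool) (-1) ^+ (s * (m + n)) :> F.
Proof.
have two0 : (2 : F) != 0 by rewrite pnatr_eq0.
rewrite big_bool mul1n expr0 -signr_odd oddD !modn2.
by case: (odd m); case: (odd n); rewrite /= ?expr0 ?expr1 ?addNr ?mulr0 ?mulVf.
Qed.

(** The extra factor of eta, the map with as many affected circles before as after, in the common
    formula [local_coefE]. *)
Definition local_scale (a b : nat) (s : bool) : F :=
  if a == b then kappa s else 1.

Lemma mu_coefE (i j k : 'I_2) : mu_coef F i j k =
  2^-1 * \sum_(s : bool) (-1) ^+ (s * i) * (-1) ^+ (s * j) * (-1) ^+ (s * k).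
Proof.
rewrite /mu_coef parity_charE; congr (_ * _); apply: eq_bigr => s _.
by rewrite -!exprD -!mulnDr addnC.
Qed.

Lemma Delta_coefE (k i j : 'I_2) : Delta_coef F k i j =
  2^-1 * \sum_(s : bool) (-1) ^+ (s * k) * ((-1) ^+ (s * i) * (-1) ^+ (s * j)).
Proof.
rewrite /Delta_coef parity_charE; congr (_ * _); apply: eq_bigr => s _.
have E : (-1) ^+ (s * (2 * 2./2)) = 1 :> F by case: s; rewrite -signr_odd.
by rewrite !mulnDr !exprD E mulr1 mulrC.
Qed.

Lemma eta_coefE (k l : 'I_2) : eta_coef F k l =
  2^-1 * \sum_(s : bool) kappa s * (-1) ^+ (s * k) * (-1) ^+ (s * l).
Proof.
rewrite /eta_coef parity_charE mulrCA mulr_sumr; congr (_ * _).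
apply: eq_bigr => s _; rewrite !mulnDr !exprD muln1 /kappa.
by ring.
Qed.

Definition one_band_sizes (a b : nat) : bool :=
  [|| (a == 1) && (b == 1), (a == 2) && (b == 1) | (a == 1) && (b == 2)]%N.

Lemma one_band_sizes_set2 (I J : finType) (i1 i2 : I) (j1 j2 : J) :
  i1 = i2 \/ j1 = j2 -> one_band_sizes #|[set i1; i2]| #|[set j1; j2]|.
Proof. by rewrite !cards2; case: eqP => E1; case: eqP => E2 //; case. Qed.

(** The matrices of mu, Delta and eta are all sums over the two characters of Z/2, with one
    character factor for each affected circle. This form does not depend on the order in which
    [enum] lists the circles. *)
Lemma local_coefE (I J : finType) (A : {set I}) (B : {set J})
    (k : I -> 'I_2) (k' : J -> 'I_2) :
  one_band_sizes #|A| #|B| ->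
  match enum A, enum B with
  | [:: c1; c2], [:: c'] => mu_coef F (k c1) (k c2) (k' c')
  | [:: c], [:: c1'; c2'] => Delta_coef F (k c) (k' c1') (k' c2')
  | [:: c], [:: c'] => eta_coef F (k c) (k' c')
  | _, _ => 0
  end =
  2^-1 * \sum_(s : bool) local_scale #|A| #|B| s *
    (\prod_(c in A) (-1) ^+ (s * k c)) * \prod_(c in B) (-1) ^+ (s * k' c).
Proof.
have EP (s : bool) :
   local_scale #|A| #|B| s * (\prod_(c in A) (-1) ^+ (s * k c)) *
     \prod_(c in B) (-1) ^+ (s * k' c) =
   local_scale (size (enum A)) (size (enum B)) s *
     (\prod_(c <- enum A) (-1) ^+ (s * k c)) * \prod_(c <- enum B) (-1) ^+ (s * k' c).
  by rewrite !big_enum -!cardE.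
rewrite (eq_bigr _ (fun s _ => EP s)) !cardE {EP}.
case: (enum A) => [|a1 [|a2 [|? ?]]] //; case: (enum B) => [|b1 [|b2 [|? ?]]] // _.
- rewrite eta_coefE; congr (_ * _); apply: eq_bigr => s _.
  by rewrite !big_cons !big_nil !mulr1.
- rewrite Delta_coefE; congr (_ * _); apply: eq_bigr => s _.
  by rewrite !big_cons !big_nil !mulr1 mul1r.
- rewrite mu_coefE; congr (_ * _); apply: eq_bigr => s _.
  by rewrite !big_cons !big_nil !mulr1 mul1r.
Qed.

Section Transfer.
Variables (I J : finType) (A : {set I}) (B : {set J}).
Variables (tr : I -> J) (tr' : J -> I).
Hypothesis trB : forall c, c \notin A -> tr c \notin B.
Hypothesis trA : forall c, c \notin B -> tr' c \notin A.
Hypothesis trK : forall c, c \notin A -> tr' (tr c) = c.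
Hypothesis trK' : forall c, c \notin B -> tr (tr' c) = c.
Variables (q : I -> bool) (r : J -> bool).
Hypothesis qr : forall c, c \notin A -> r (tr c) = q c.
Hypothesis szAB : one_band_sizes #|A| #|B|.

(* The tensor product over [c] of the 1 + (-1)^(p c) x, rescaled by kappa. *)
Definition color_vec (L : finType) (p : L -> bool) (k : {ffun L -> 'I_2}) : F :=
  \prod_c ((kappa (p c))^-1 * (-1) ^+ (p c * k c)).

(* The matrix of the map of a half-twist, with [A] and [B] the affected circles
   before and after it and [tr] the identification of the other ones. *)
Definition transfer_coef (k : {ffun I -> 'I_2}) (k' : {ffun J -> 'I_2}) : F :=
  [forall c, (c \notin A) ==> (k c == k' (tr c))]%:R *
  (2^-1 * \sum_(s : bool) local_scale #|A| #|B| s *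
    (\prod_(c in A) (-1) ^+ (s * k c)) * \prod_(c in B) (-1) ^+ (s * k' c)).

(** For a fixed character [s] the sum over [k] is a product over circles: an affected circle gives
    an orthogonality relation between [s] and its color, any other one must have the exponent
    prescribed by [k']. *)
Lemma sum_transfer (k' : {ffun J -> 'I_2}) :
  \sum_k color_vec q k * transfer_coef k k' =
  2^-1 * \sum_(s : bool) local_scale #|A| #|B| s *
    (\prod_(c in B) (-1) ^+ (s * k' c)) *
    ((\prod_(c in A) ((kappa (q c))^-1 * (2 * (s == q c)%:R))) *
     \prod_(c | c \notin B) ((kappa (r c))^-1 * (-1) ^+ (r c * k' c))).
Proof.
pose f s (c : I) (j : 'I_2) : F := (kappa (q c))^-1 * (-1) ^+ (q c * j) *
  (if c \in A then (-1) ^+ (s * j) else (j == k' (tr c))%:R).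
transitivity (2^-1 * \sum_(s : bool) local_scale #|A| #|B| s *
    (\prod_(c in B) (-1) ^+ (s * k' c)) * \prod_c \sum_j f s c j).
  rewrite mulr_sumr.
  under [RHS]eq_bigr => s _ do rewrite bigA_distr_bigA 2!mulr_sumr /=.
  rewrite exchange_big /=; apply: eq_bigr => k _.
  have agE : [forall c, (c \notin A) ==> (k c == k' (tr c))]%:R =
      \prod_c (if c \in A then 1 else (k c == k' (tr c))%:R) :> F.
    by rewrite natr_forall; apply: eq_bigr => c _; case: (c \in A).
  rewrite /transfer_coef agE mulrA [LHS]mulrCA [in LHS]mulr_sumr mulr_sumr.
  apply: eq_bigr => s _.
  rewrite (big_mkcond (mem A)) /=.
  have -> : \prod_c f s c (k c) = color_vec q k *
     (\prod_c (if c \in A then 1 else (k c == k' (tr c))%:R)) *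
     \prod_c (if c \in A then (-1) ^+ (s * k c) else 1).
    rewrite -!big_split /=; apply: eq_bigr => c _.
    by rewrite /f; case: ifP => _; rewrite ?mulr1 ?mul1r.
  by ring.
congr (_ * _); apply: eq_bigr => s _; congr (_ * _).
rewrite (bigID (mem A)) /=; congr (_ * _).
  apply: eq_bigr => c cA; rewrite /f cA sum_ord2 /= !muln0 !muln1 expr0 !mulr1.
  case: s; case: (q c); rewrite /= ?expr0 ?expr1 ?mulr1 ?mulrN1 ?opprK ?mulr0 ?subrr ?addNr //;
  by ring.
rewrite [RHS](reindex_onto tr tr') //=; apply: eq_big => [c | c nc].
  apply/idP/andP => [nc | [nc /eqP Ec]]; first by rewrite trB // trK.
  by rewrite -Ec trA.
rewrite /f (negbTE nc) qr // (bigD1 (k' (tr c))) //= eqxx mulr1 big1 ?addr0 //.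
by move=> j /negbTE ->; rewrite mulr0.
Qed.

(** No [s] equals both colors, so each summand has a vanishing factor. *)
Lemma sum_transfer_mixed (k' : {ffun J -> 'I_2}) c1 c2 :
  c1 \in A -> c2 \in A -> q c1 != q c2 ->
  \sum_k color_vec q k * transfer_coef k k' = 0.
Proof.
move=> A1 A2 n12; rewrite sum_transfer big1 ?mulr0 // => s _.
have [E|ns] := eqVneq s (q c1).
  by rewrite (bigD1 c2) //= E (negbTE n12) !mulr0 !mul0r mulr0.
by rewrite (bigD1 c1) //= (negbTE ns) !mulr0 !mul0r mulr0.
Qed.

(** Only [s = t] survives, and in each of the three cases 2^-1 * scale * kappa^|A| = kappa *
    kappa^-|B| because kappa^2 = 2; the rescaling of circles by kappa is chosen for this. *)
Lemma sum_transfer_const (k' : {ffun J -> 'I_2}) t :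
  (forall c, c \in A -> q c = t) -> (forall c, c \in B -> r c = t) ->
  \sum_k color_vec q k * transfer_coef k k' = kappa t * color_vec r k'.
Proof.
move=> qt rt; rewrite sum_transfer.
have kn := kappa_neq0 t; have two0 : (2 : F) != 0 by rewrite pnatr_eq0.
have k2 : 2 / kappa t = kappa t by rewrite -(sqr_kappa t) mulfK.
transitivity (2^-1 * \sum_(s : bool) local_scale #|A| #|B| s *
    (\prod_(c in B) (-1) ^+ (s * k' c)) *
    (((s == t)%:R * kappa t) ^+ #|A| *
     \prod_(c | c \notin B) ((kappa (r c))^-1 * (-1) ^+ (r c * k' c)))).
  congr (_ * _); apply: eq_bigr => s _; congr (_ * (_ * _)).
  rewrite -prodr_const; apply: eq_bigr => c cA.
  by rewrite qt // mulrA [_ * 2]mulrC k2 mulrC.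
have A0 : (0 < #|A|)%N by case/or3P: szAB => /andP[/eqP -> _].
rewrite (bigD1 t) //= [X in _ + X]big1 ?addr0; last first.
  by move=> s /negbTE ->; rewrite mul0r expr0n eqn0Ngt A0 /= mul0r mulr0.
have -> : color_vec r k' = (kappa t)^-1 ^+ #|B| *
    (\prod_(c in B) (-1) ^+ (t * k' c)) *
    \prod_(c | c \notin B) ((kappa (r c))^-1 * (-1) ^+ (r c * k' c)).
  rewrite /color_vec (bigID (mem B)) /=; congr (_ * _).
  by rewrite -prodr_const -big_split /=; apply: eq_bigr => c cB; rewrite rt.
rewrite eqxx mul1r /local_scale.
move: szAB (\prod_(c in B) _) (\prod_(c | c \notin B) _) => sz P R.
have -> : 2^-1 = (kappa t)^-1 * (kappa t)^-1 by rewrite -invfM sqr_kappa.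
by case/or3P: sz => /andP[/eqP -> /eqP ->]; rewrite /= ?expr1 ?expr2; field.
Qed.

End Transfer.
End Frobenius.

(** * The map of a half-twist on colorings *)

Section Partial.
Variables (F : numClosedFieldType) (G : multigraph) (Gamma : ribbon_graph G).
Hypothesis tri : trivalent G.
Hypothesis noloop : loop G -> False.
Implicit Types (alpha beta : state G) (h : half_edge G).

Notation G_ alpha := (add_twists Gamma alpha).
Notation mono alpha := (monomial 2 Gamma alpha).

Definition const_on alpha (p : bpoint G -> bool) : bool :=
  locally_constant (badj (G_ alpha)) p.

Lemma const_on_circ alpha p q : const_on alpha p ->
  class_value p (val (circ Gamma alpha q)) = p q.
Proof.
move=> Hp; apply: (class_valueE (badj_sym (G_ alpha)) Hp) (valP _) (mem_circ _ _ _).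
Qed.

(** If the two sides of [h] have the same color, all four points of the band do, and the condition
    along the band holds for either twist. *)
Lemma const_on_differ h alpha beta p : differ_at h alpha beta ->
  const_on alpha p -> p (bpt h false) = p (bpt h true) -> const_on beta p.
Proof.
move=> D Hp0 E; have /locally_constantP Hp := Hp0.
have Eh s : p (bpt h s) = p (bpt h false) by case: s; rewrite ?E.
have Eo s : p (bpt (other_half h) s) = p (bpt h false).
  by rewrite -(Eh (s (+) ~~ twist (G_ alpha) h.1)); apply/esym/Hp;
    rewrite /= !eqxx -addbA addbb addbF eqxx !orbT.
have onB q : q \in on_band h -> p q = p (bpt h false).
  rewrite inE; case: q => [[g s]|//] /eqP gh.
  have [->|ng] := eqVneq g h; first exact: Eh.
  by rewrite (other_halfE gh ng); apply: Eo.
apply/locally_constantP => q q' adj.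
have [qB|nq] := boolP (q \in on_band h); last by apply: Hp; rewrite (badj_differ Gamma D nq).
have [qB'|nq'] := boolP (q' \in on_band h); first by rewrite !onB.
by apply/esym/Hp; rewrite (badj_differ Gamma D nq') badj_sym.
Qed.

(** [p] lives on the marked points, which are common to all states, so one coloring names a vector
    in every state on whose circles it is constant. *)
Definition coloring_vec alpha (p : bpoint G -> bool) (k : mono alpha) : F :=
  color_vec F (fun c : circle (G_ alpha) => class_value p (val c)) k.

(** Unaffected circles are the same sets of marked points in both states; the default circle can
    occur only for affected ones. *)
Definition transport alpha beta h (c : circle (G_ alpha)) : circle (G_ beta) :=
  insubd (circ Gamma beta (bpt h false)) (val c).

Section OneBand.
Variables (h : half_edge G) (alpha beta : state G).
Hypothesis D : differ_at h alpha beta.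

Lemma val_transport (c : circle (G_ alpha)) : c \notin affected Gamma alpha beta ->
  val (transport beta h c) = val c.
Proof. by move=> nc; rewrite val_insubd (unaffected_boundary D nc). Qed.

Lemma transport_unaffected (c : circle (G_ alpha)) :
  c \notin affected Gamma alpha beta ->
  transport beta h c \notin affected Gamma beta alpha.
Proof.
by move=> nc; apply: (unaffected_unaffected D nc); apply: val_transport.
Qed.

Lemma one_band_affected :
  one_band_sizes #|affected Gamma alpha beta| #|affected Gamma beta alpha|.
Proof.
have := affected_join Gamma tri noloop D.
rewrite (affectedE Gamma D) (affectedE Gamma (differ_at_sym D)).
exact: one_band_sizes_set2.
Qed.

Lemma hat_partial_coefE (k : mono alpha) (k' : mono beta) :
  hat_partial_coef F k k' = transfer_coef F (affected Gamma alpha beta)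
    (affected Gamma beta alpha) (transport beta h) k k'.
Proof.
rewrite /hat_partial_coef local_coefE; last exact: one_band_affected.
congr ((nat_of_bool _)%:R * _); apply: eq_forallb => c.
apply/forallP/implyP => [H nc | H c'].
  have := H (transport beta h c).
  by rewrite nc transport_unaffected // val_transport // eqxx.
apply/implyP => /and3P[nc _ /eqP Ec]; suff <- : transport beta h c = c' by exact: H.
by apply: val_inj; rewrite val_transport.
Qed.

End OneBand.

Lemma transportK h alpha beta (c : circle (G_ alpha)) : differ_at h alpha beta ->
  c \notin affected Gamma alpha beta -> transport alpha h (transport beta h c) = c.
Proof.
move=> D nc; apply: val_inj.
by rewrite (val_transport (differ_at_sym D)) ?val_transport ?transport_unaffected.
Qed.

Lemma hat_partial_coloring h alpha beta (p : bpoint G -> bool) (k' : mono beta) :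
  differ_at h alpha beta -> const_on alpha p ->
  \sum_(k : mono alpha) coloring_vec p k * hat_partial_coef F k k' =
  (p (bpt h false) == p (bpt h true))%:R * kappa F (p (bpt h false)) *
    coloring_vec p k'.
Proof.
move=> D Hp; have D' := differ_at_sym D.
under eq_bigr => k _ do rewrite (hat_partial_coefE D).
pose r (c : circle (G_ beta)) := class_value p (val c).
have qr (c : circle (G_ alpha)) : c \notin affected Gamma alpha beta ->
    r (transport beta h c) = class_value p (val c).
  by move=> nc; rewrite /r val_transport.
have hA s : circ Gamma alpha (bpt h s) \in affected Gamma alpha beta.
  by rewrite (affectedE _ D) !inE; case: s; rewrite eqxx ?orbT.
have valA s := const_on_circ (bpt h s) Hp.
have tB := transport_unaffected D; have tA := transport_unaffected D'.
have tK (c : circle (G_ alpha)) := @transportK h alpha beta c D.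
have tK' (c : circle (G_ beta)) := @transportK h beta alpha c D'.
have [Epp|npp] := eqVneq (p (bpt h false)) (p (bpt h true)); last first.
  rewrite !mul0r; apply: (sum_transfer_mixed F tB tA tK tK' qr k' (hA false) (hA true)).
  by rewrite !valA.
have Hq : const_on beta p by exact: const_on_differ D Hp Epp.
have valB s := const_on_circ (bpt h s) Hq.
rewrite mul1r; apply: (sum_transfer_const F tB tA tK tK' qr (one_band_affected D)).
  by move=> c; rewrite (affectedE _ D) !inE => /orP[] /eqP ->; rewrite valA.
by move=> c; rewrite (affectedE _ D') !inE => /orP[] /eqP ->; rewrite /r valB.
Qed.

End Partial.

Lemma nth_notin_take (T : eqType) (x0 : T) (s : seq T) j :
  uniq s -> (j < size s)%N -> nth x0 s j \notin take j s.
Proof.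
move=> us ltj; have := take_uniq j.+1 us.
by rewrite (take_nth x0) // rcons_uniq => /andP[].
Qed.

Section FreeSpaceTheory.
Variable F : fieldType.

Lemma linear_ofE (I J : finType) (a : I -> J -> F) (f : free_space F I) j :
  (linear_of a f : free_space F J) j = \sum_i f i * a i j.
Proof. by rewrite lfunE /= ffunE. Qed.

Lemma free_space_sum (I : finType) (f : free_space F I) :
  f = \sum_i (f i : F) *: basis_vector F i.
Proof.
apply/ffunP => j; rewrite sum_ffunE (bigD1 j) //= !ffunE eqxx [_ *: _]mulr1 big1 ?addr0 //.
by move=> i ij; rewrite !ffunE eq_sym (negbTE ij) [_ *: _]mulr0.
Qed.

End FreeSpaceTheory.

(** * The differential on colorings and its square *)

Section Differential.
Variables (F : numClosedFieldType) (G : multigraph) (Gamma : ribbon_graph G).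
Hypothesis tri : trivalent G.
Hypothesis noloop : loop G -> False.
Implicit Types (alpha beta : state G) (h : half_edge G) (nu : vstate G).

Notation G_ alpha := (add_twists Gamma alpha).
Notation mono alpha := (monomial 2 Gamma alpha).

Definition cvec alpha (p : bpoint G -> bool) : hatA F 2 Gamma alpha :=
  [ffun k => coloring_vec F p k].

Definition half_factor (p : bpoint G -> bool) h : F :=
  (p (bpt h false) == p (bpt h true))%:R * kappa F (p (bpt h false)).

Lemma hat_partial_cvec h alpha beta p : differ_at h alpha beta ->
  const_on Gamma alpha p ->
  hat_partial F 2 Gamma alpha beta (cvec alpha p) = half_factor p h *: cvec beta p.
Proof.
move=> D Hp; apply/ffunP => k'; rewrite linear_ofE !ffunE.
rewrite -[RHS](hat_partial_coloring F tri noloop k' D Hp).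
by apply: eq_bigr => k _; rewrite ffunE.
Qed.

Lemma half_factor_const h alpha beta p : differ_at h alpha beta ->
  const_on Gamma alpha p -> half_factor p h != 0 -> const_on Gamma beta p.
Proof.
move=> D Hp; rewrite /half_factor.
have [E _|_] := eqVneq (p (bpt h false)); last by rewrite mul0r eqxx.
exact: const_on_differ D Hp E.
Qed.

Definition vertex_factor (p : bpoint G -> bool) v : F :=
  \prod_(h <- enum (half_edges_at v)) half_factor p h.

(** Induction along the path: in [alpha] the first [j] half-edges of [hs] are already twisted, and
    each further step multiplies by its own factor. If a factor vanishes, [p] may stop being
    constant on the circles, but then the image is 0 and nothing more is claimed about [p]. *)
Lemma hat_partial_along_cvec nu v (hs : seq (half_edge G)) alpha j p :
  uniq hs -> (j < size hs)%N ->
  (forall h, alpha h = alpha_of nu h || (h \in take j hs)) ->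
  (forall h, h \in hs -> alpha_of nu h = false) ->
  (forall h, alpha_of (raise nu v) h = alpha_of nu h || (h \in hs)) ->
  const_on Gamma alpha p ->
  let c := \prod_(h <- drop j hs) half_factor p h in
  hat_partial_along F 2 Gamma alpha
     [seq [ffun h => alpha_of nu h || (h \in take i hs)] | i <- iota j.+1 (size hs - j.+1)]
     (alpha_of (raise nu v)) (cvec alpha p) = c *: cvec (alpha_of (raise nu v)) p
  /\ (c != 0 -> const_on Gamma (alpha_of (raise nu v)) p).
Proof.
move=> uhs; move En : (size hs - j.+1)%N => n.
elim: n alpha j En => [|n IH] alpha j En ltj Ealpha nuhs Eraise Hp c.
  have Ej : j.+1 = size hs by apply/eqP; rewrite eqn_leq ltj -subn_eq0 En.
  have h0 : half_edge G by case: (hs) ltj.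
  have D : differ_at (nth h0 hs j) alpha (alpha_of (raise nu v)).
    move=> h; rewrite Ealpha Eraise -[in LHS](cat_take_drop j hs) (drop_nth h0) //.
    rewrite Ej drop_size mem_cat inE.
    have [->|_] := eqVneq h (nth h0 hs j); last by rewrite orbF addbF.
    rewrite nuhs ?mem_nth // orbT /=.
    by rewrite (negbTE (nth_notin_take h0 uhs ltj)).
  have -> : c = half_factor p (nth h0 hs j).
    by rewrite /c (drop_nth h0) // Ej drop_size big_seq1.
  split; first exact: hat_partial_cvec.
  exact: half_factor_const Hp.
have ltj1 : (j.+1 < size hs)%N by rewrite -subn_gt0 En.
have h0 : half_edge G by case: (hs) ltj.
set beta : state G := [ffun h => alpha_of nu h || (h \in take j.+1 hs)].
have Eb h : beta h = alpha_of nu h || (h \in take j.+1 hs) by rewrite ffunE.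
have D : differ_at (nth h0 hs j) alpha beta.
  move=> h; rewrite Ealpha Eb (take_nth h0) // mem_rcons inE.
  have [->|_] := eqVneq h (nth h0 hs j); last by rewrite addbF.
  rewrite nuhs ?mem_nth //=.
  by rewrite (negbTE (nth_notin_take h0 uhs ltj)).
have Ec : c = half_factor p (nth h0 hs j) * \prod_(h <- drop j.+1 hs) half_factor p h.
  by rewrite /c (drop_nth h0) // big_cons.
rewrite /= -/beta comp_lfunE (hat_partial_cvec D Hp) linearZ /=.
have [E0|n0] := eqVneq (half_factor p (nth h0 hs j)) 0.
  by rewrite Ec E0 mul0r !scale0r eqxx.
have Hq := half_factor_const D Hp n0.
have En1 : (size hs - j.+2 = n)%N by rewrite subnS En.
have [-> Hc] := IH beta j.+1 En1 ltj1 Eb nuhs Eraise Hq.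
split; first by rewrite scalerA Ec.
by rewrite Ec mulf_eq0 negb_or => /andP[_]; apply: Hc.
Qed.

Lemma hat_delta_at_cvec nu v p : ~~ nu v -> const_on Gamma (alpha_of nu) p ->
  hat_delta_at F 2 Gamma nu v (raise nu v) (cvec (alpha_of nu) p)
    = vertex_factor p v *: cvec (alpha_of (raise nu v)) p
  /\ (vertex_factor p v != 0 -> const_on Gamma (alpha_of (raise nu v)) p).
Proof.
move=> nv Hp; rewrite /hat_delta_at /path_at /vertex_factor.
set hs := enum _.
have mem_hs h : (h \in hs) = (endpoint h == v) by rewrite mem_enum inE.
have szh : (0 < size hs)%N by rewrite -cardE tri.
have := @hat_partial_along_cvec nu v hs (alpha_of nu) 0 p (enum_uniq _) szh.
rewrite subn1 drop0 take0; apply => //.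
- by move=> h; rewrite orbF.
- by move=> h; rewrite mem_hs ffunE => /eqP ->; apply/negbTE.
by move=> h; rewrite mem_hs !ffunE.
Qed.

Definition gvec nu (p : bpoint G -> bool) : hatC F 2 Gamma :=
  [ffun x : generator 2 Gamma => if tag x == nu then coloring_vec F p (tagged x) else 0].

Definition delta_factor nu p v : F :=
  (-1) ^+ ones_before nu v * vertex_factor p v.

Lemma hat_delta_gvec nu p : const_on Gamma (alpha_of nu) p ->
  hat_delta F 2 Gamma (gvec nu p) =
  \sum_(v | ~~ nu v) delta_factor nu p v *: gvec (raise nu v) p.
Proof.
move=> Hp; apply/ffunP => -[nu' k']; rewrite linear_ofE sum_ffunE.
pose F1 (nu1 : vstate G) (k : mono (alpha_of nu1)) : F :=
  (if nu1 == nu then coloring_vec F p k else 0) *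
  \sum_(v | ~~ nu1 v && (nu' == raise nu1 v)) (-1) ^+ ones_before nu1 v *
    (hat_delta_at F 2 Gamma nu1 v nu' (basis_vector F k) : hatA _ _ _ _) k'.
transitivity (\sum_(nu1 : vstate G) \sum_(k : mono (alpha_of nu1)) F1 nu1 k).
  rewrite (sig_big_dep _ (fun _ => xpredT)); apply: eq_big => // x _.
  by rewrite ffunE /F1 /hat_delta_coef.
rewrite (bigD1 nu) //= [X in _ + X]big1 ?addr0; last first.
  by move=> nu1 /negbTE n1; rewrite big1 // => k _; rewrite /F1 n1 mul0r.
under eq_bigr => k _ do rewrite /F1 eqxx mulr_sumr.
rewrite exchange_big /= [RHS](eq_bigr (fun v => if nu' == raise nu v then
   delta_factor nu p v * (coloring_vec F p k') else 0)); last first.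
  by move=> v _; rewrite !ffunE /=; case: ifP => _; [|rewrite [LHS]mulr0].
rewrite -big_mkcondr; apply: eq_bigr => v /andP[nv /eqP E]; subst nu'.
have [Ed _] := hat_delta_at_cvec nv Hp.
transitivity ((-1) ^+ ones_before nu v *
  (hat_delta_at F 2 Gamma nu v (raise nu v) (cvec (alpha_of nu) p) : hatA _ _ _ _) k').
  rewrite [X in hat_delta_at _ _ _ _ _ _ X]free_space_sum linear_sum sum_ffunE mulr_sumr.
  apply: eq_bigr => k _; rewrite linearZ /= mulrCA; congr (_ * _).
  by rewrite !ffunE.
by rewrite Ed !ffunE /delta_factor -mulrA.
Qed.

Lemma raiseC nu v w : raise (raise nu v) w = raise (raise nu w) v.
Proof. by apply/ffunP => u; rewrite !ffunE orbAC. Qed.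

Lemma ones_before_raise nu v w : ~~ nu v ->
  ones_before (raise nu v) w = (ones_before nu w + (enum_rank v < enum_rank w))%N.
Proof.
move=> nv; rewrite /ones_before.
have [ltvw|gewv] := ltnP (enum_rank v) (enum_rank w).
  rewrite (cardsD1 v) !inE ffunE eqxx orbT ltvw addnC; congr addn.
  apply: eq_card => u; rewrite !inE ffunE.
  by have [->|] := eqVneq u v; rewrite ?(negbTE nv) ?orbF.
rewrite addn0; apply: eq_card => u; rewrite !inE ffunE.
by have [->|] := eqVneq u v; rewrite ?orbF // ltnNge gewv !andbF.
Qed.

(** The vertex factors depend only on [p], so raising [v] and [w] in either order gives the same
    vector, with opposite signs because of [ones_before]. *)
Lemma hat_delta_sq_gvec nu p : const_on Gamma (alpha_of nu) p ->
  hat_delta F 2 Gamma (hat_delta F 2 Gamma (gvec nu p)) = 0.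
Proof.
move=> Hp; rewrite hat_delta_gvec // linear_sum /=.
pose T v w : hatC F 2 Gamma := if [&& ~~ nu v, ~~ nu w & w != v] then
  (delta_factor nu p v * delta_factor (raise nu v) p w) *:
    gvec (raise (raise nu v) w) p else 0.
set S := (X in X = 0); have ES : S = \sum_v \sum_w T v w.
  rewrite /S big_mkcond /=; apply: eq_bigr => v _; rewrite /T.
  case: ifP => nv /=; last by rewrite big1.
  rewrite linearZ /=; have [_ Hq] := hat_delta_at_cvec nv Hp.
  (* When the factor vanishes, [p] need not be constant on the circles of [raise nu v], but both
     sides are 0. *)
  have [E0|n0] := eqVneq (vertex_factor p v) 0.
    by rewrite /delta_factor E0 mulr0 scale0r big1 // => w _; rewrite mul0r scale0r if_same.
  rewrite hat_delta_gvec ?Hq // scaler_sumr -big_mkcond /=.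
  by apply: eq_big => [w | w _]; rewrite ?scalerA // ffunE negb_or.
have TN v w : T w v = - T v w.
  rewrite /T [v == w]eq_sym andbCA; case: ifP => [/and3P[nv nw nvw]|_]; last by rewrite oppr0.
  rewrite raiseC -scaleNr; congr (_ *: _); rewrite /delta_factor !ones_before_raise // !exprD.
  have : (enum_rank v < enum_rank w)%N = ~~ (enum_rank w < enum_rank v)%N.
    by rewrite -leqNgt ltn_neqAle (inj_eq val_inj) (inj_eq enum_rank_inj) eq_sym nvw.
  by move=> ->; case: (_ < _)%N; rewrite /= expr0 expr1; ring.
have SN : S = - S.
  rewrite {1}ES exchange_big ES -sumrN; apply: eq_bigr => v _.
  by rewrite -sumrN; apply: eq_bigr => w _; apply: TN.
have : 2%:R *: S = 0 by rewrite scaler_nat mulr2n {1}SN addNr.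
by move/eqP; rewrite scaler_eq0 pnatr_eq0 /= => /eqP.
Qed.

(** Fourier inversion on each circle: x^k is the average over [s] of (-1)^(s k) (1 + (-1)^s x), and
    kappa undoes the rescaling in [color_vec]. Thus linear identities checked on colorings hold on
    the whole complex. *)
Lemma basis_gvec (x : generator 2 Gamma) :
  basis_vector F x = \sum_(q : {ffun circle (G_ (alpha_of (tag x))) -> bool})
    (\prod_c (2^-1 * (kappa F (q c) * (-1) ^+ (q c * tagged x c)))) *:
    gvec (tag x) (fun z => q (circ Gamma (alpha_of (tag x)) z)).
Proof.
case: x => nu k; apply/ffunP => -[nu' k']; rewrite sum_ffunE ffunE /=.
have [E|ne] := eqVneq nu' nu; last first.
  rewrite big1 => [|q _]; last by rewrite !ffunE /= (negbTE ne) [LHS]mulr0.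
  apply/eqP; rewrite pnatr_eq0 eqb0; apply: contraNneq ne => E.
  exact/eqP/(congr1 tag E).
subst nu'; rewrite eq_Tagged /=.
have qv (q : {ffun circle (G_ (alpha_of nu)) -> bool}) c :
    class_value (fun z => q (circ Gamma (alpha_of nu) z)) (val c) = q c.
  have [z zc] := class_neq0 (badj_sym _) (valP c).
  rewrite (class_valueE (badj_sym _) _ (valP c) zc) ?(circE zc) //.
  exact: locally_constant_class_of.
transitivity (\sum_(q : {ffun circle (G_ (alpha_of nu)) -> bool}) \prod_c
   (2^-1 * (-1) ^+ (q c * (k c + k' c))) : F); last first.
  apply: eq_bigr => q _; rewrite !ffunE eqxx -[RHS]big_split /=.
  apply: eq_bigr => c _; rewrite qv mulnDr exprD.
  move: (kappa_neq0 F (q c)); move: (kappa F (q c)) => K K0.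
  by rewrite -[RHS]mulrA; congr (_ * _); rewrite [RHS]mulrACA mulfV // mul1r.
rewrite -(bigA_distr_bigA (fun c (s : bool) => 2^-1 * (-1) ^+ (s * (k c + k' c)))) /=.
under eq_bigr => c _ do rewrite -mulr_sumr -parity_charE.
rewrite -natr_forall; congr (nat_of_bool _)%:R.
apply/eqP/forallP => [->//|H]; apply/ffunP => c.
have := H c; rewrite !modn_small // => /eqP E; exact/val_inj.
Qed.

Lemma hat_delta_sq (f : hatC F 2 Gamma) :
  hat_delta F 2 Gamma (hat_delta F 2 Gamma f) = 0.
Proof.
rewrite (free_space_sum f) !linear_sum big1 // => x _; rewrite !linearZ /=.
rewrite basis_gvec !linear_sum big1 ?scaler0 // => q _.
rewrite !linearZ /= hat_delta_sq_gvec ?scaler0 //.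
exact: locally_constant_class_of.
Qed.

End Differential.

(** * Euler characteristic *)

Section GradedEuler.
Variables (F : fieldType) (X : finType) (wt : X -> nat) (N : nat).
Hypothesis wt_le : forall x, (wt x <= N)%N.
Variable d : 'End(free_space F X).
Hypothesis d_sq : forall f, d (d f) = 0.
Hypothesis d_graded : forall x y,
  (d (basis_vector F x) : free_space F X) y != 0 -> wt y = (wt x).+1.

Definition homogeneous (i : nat) : {vspace free_space F X} :=
  <<[seq basis_vector F x | x <- enum X & wt x == i]>>%VS.

Lemma span_basis_vectors0 (s : seq X) (f : free_space F X) x :
  f \in <<[seq basis_vector F x | x <- s]>>%VS -> x \notin s -> f x = 0.
Proof.
move=> fs xs.
rewrite (coord_span (X := in_tuple [seq basis_vector F x | x <- s]) fs).
rewrite sum_ffunE big1 // => i _.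
have lti : (i < size s)%N by rewrite -(size_map (@basis_vector F X) s).
rewrite ffunE (nth_map x) // ffunE.
case: eqP => [E|_]; last by rewrite [LHS]mulr0.
by rewrite E mem_nth in xs.
Qed.

Lemma homogeneousP i (f : free_space F X) :
  reflect (forall x, wt x != i -> f x = 0) (f \in homogeneous i).
Proof.
apply: (iffP idP) => [fi x wx | fi].
  by apply: span_basis_vectors0 fi _; rewrite mem_filter (negbTE wx).
rewrite (free_space_sum f); apply: memv_suml => x _.
have [wx|wx] := eqVneq (wt x) i; last by rewrite fi // scale0r mem0v.
apply/memvZ/memv_span/mapP; exists x => //.
by rewrite mem_filter wx eqxx mem_enum.
Qed.

Lemma dim_homogeneous i : \dim (homogeneous i) = #|[pred x | wt x == i]|.
Proof.
have fr (s : seq X) : uniq s -> free [seq basis_vector F x | x <- s].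
  elim: s => [|x s IH] /=; first by rewrite nil_free.
  case/andP=> xs us; rewrite free_cons IH // andbT.
  apply/negP => /span_basis_vectors0/(_ xs); rewrite ffunE eqxx => /eqP.
  by rewrite oner_eq0.
have /eqP -> := fr [seq x <- enum X | wt x == i] (filter_uniq _ (enum_uniq _)).
by rewrite size_map size_filter -sum1_count -sum1_card big_enum_cond.
Qed.

Lemma d_sum (f : free_space F X) y :
  (d f : free_space F X) y = \sum_x f x * (d (basis_vector F x) : free_space F X) y.
Proof.
rewrite [in LHS](free_space_sum f) linear_sum sum_ffunE.
by apply: eq_bigr => x _; rewrite linearZ ffunE.
Qed.

(** Since [d] raises the weight by one, a boundary of weight [i.+1] is the image of the weight [i]
    component of any preimage. *)
Lemma d_homogeneous i : (d @: homogeneous i = homogeneous i.+1 :&: limg d)%VS.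
Proof.
apply/vspaceP => y; rewrite memv_cap; apply/memv_imgP/andP.
  case=> f /homogeneousP fi ->; split; last exact: memv_img (memvf f).
  apply/homogeneousP => z wz; rewrite d_sum big1 // => x _.
  have [wx|/fi ->] := eqVneq (wt x) i; last by rewrite mul0r.
  have [->|/d_graded E] := eqVneq ((d (basis_vector F x) : free_space F X) z) 0.
    by rewrite mulr0.
  by rewrite E wx eqxx in wz.
case=> /homogeneousP yi /memv_imgP[f _ Ey].
exists [ffun x => if wt x == i then f x else 0].
  by apply/homogeneousP => x /negbTE wx; rewrite ffunE wx.
apply/ffunP => z; have [wz|wz] := eqVneq (wt z) i.+1; last first.
  rewrite yi // d_sum big1 // => x _; rewrite ffunE.
  have [wx|] := eqVneq (wt x) i; last by rewrite mul0r.
  have [->|/d_graded E] := eqVneq ((d (basis_vector F x) : free_space F X) z) 0.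
    by rewrite mulr0.
  by rewrite E wx eqxx in wz.
rewrite Ey !d_sum; apply: eq_bigr => x _; rewrite ffunE.
have [//|wx] := eqVneq (wt x) i.
have [->|/d_graded E] := eqVneq ((d (basis_vector F x) : free_space F X) z) 0.
  by rewrite !mulr0.
by move: E; rewrite wz => -[E]; rewrite E eqxx in wx.
Qed.

Lemma image_homogeneous0 : (homogeneous 0 :&: limg d = 0)%VS.
Proof.
apply/eqP; rewrite -subv0; apply/subvP => y; rewrite memv_cap memv0.
case/andP=> /homogeneousP y0 /memv_imgP[f _ Ey]; apply/eqP/ffunP => z.
rewrite [RHS]ffunE; have [wz|] := eqVneq (wt z) 0; last exact: y0.
rewrite Ey d_sum big1 // => x _.
have [->|/d_graded E] := eqVneq ((d (basis_vector F x) : free_space F X) z) 0.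
  by rewrite mulr0.
by rewrite E in wz.
Qed.

Lemma homogeneous_gt : homogeneous N.+1 = 0%VS.
Proof.
apply/eqP; rewrite -subv0; apply/subvP => y /homogeneousP yN; rewrite memv0.
apply/eqP/ffunP => z; rewrite [RHS]ffunE; apply: yN.
by rewrite neq_ltn ltnS wt_le.
Qed.

Definition homology (i : nat) : {vspace free_space F X} :=
  ((homogeneous i :&: lker d) :\: (homogeneous i :&: limg d))%VS.

(** Rank-nullity for [d] on degree [i]; as [d] squares to 0, the boundaries lie in the cycles, and
    the complement has the difference of the dimensions. *)
Lemma dim_homology i : \dim (homogeneous i) =
  (\dim (homology i) + \dim (homogeneous i :&: limg d) +
   \dim (homogeneous i.+1 :&: limg d))%N.
Proof.
rewrite -(limg_ker_dim d) d_homogeneous; congr addn.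
rewrite -(dimv_cap_compl _ (homogeneous i :&: limg d)) addnC; congr (_ + \dim _)%N.
apply/capv_idPr; rewrite subv_cap capvSl; apply/subvP => y.
by rewrite memv_cap memv_ker => /andP[_ /memv_imgP[f _ ->]]; rewrite d_sq.
Qed.

Lemma euler_homology :
  \sum_(0 <= i < N.+1) (-1) ^+ i * (\dim (homology i))%:Z =
  \sum_x (-1) ^+ wt x :> int.
Proof.
transitivity (\sum_(0 <= i < N.+1) (-1) ^+ i * (\dim (homogeneous i))%:Z : int); last first.
  rewrite big_mkord (partition_big (fun x => inord (wt x) : 'I_N.+1) predT) //=.
  apply: eq_bigr => i _; rewrite dim_homogeneous.
  have E x : (inord (wt x) == i :> 'I_N.+1) = (wt x == i).
    by rewrite -(inj_eq val_inj) /= inordK // ltnS.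
  rewrite (eq_bigl _ _ E) (eq_bigr (fun _ => (-1) ^+ i)); last by move=> x /eqP ->.
  by rewrite sumr_const -mulr_natr natz.
(* The dimensions of the boundaries telescope in the alternating sum, and both ends vanish. *)
pose b i : int := (\dim (homogeneous i :&: limg d))%:Z.
have tel n : \sum_(0 <= i < n) (-1) ^+ i * (b i + b i.+1) = b 0 - (-1) ^+ n * b n.
  elim: n => [|n IH]; first by rewrite big_nil expr0 mul1r subrr.
  by rewrite big_nat_recr //= IH exprS; ring.
have b0 : b 0 = 0 by rewrite /b image_homogeneous0 dimv0.
have bN : b N.+1 = 0 by rewrite /b homogeneous_gt cap0v dimv0.
apply/eqP; rewrite -subr_eq0 -sumrB.
under eq_bigr => i _ do
  rewrite dim_homology !PoszD -mulrBr -addrA opprD addrA subrr add0r mulrN.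
by rewrite sumrN tel b0 bN mulr0 subrr oppr0.
Qed.

End GradedEuler.

(** A vertex-less edge is an isolated point of [adjacent]. *)
Lemma connected_noloop (G : multigraph) :
  (0 < #|vertex G|)%N -> connected G -> loop G -> False.
Proof.
move=> /card_gt0P[v _] [_ conn] l.
case/connectP: (conn (inl v) (inr l)) => s.
elim: s v => [|[w|//] s IH] v //= /andP[_]; exact: IH.
Qed.

Lemma weight_raise (G : multigraph) (nu : vstate G) v :
  ~~ nu v -> weight (raise nu v) = (weight nu).+1.
Proof.
move=> nv; rewrite /weight (cardsD1 v) inE ffunE eqxx orbT add1n; congr _.+1.
apply: eq_card => w; rewrite !inE ffunE.
by have [->|] := eqVneq w v; rewrite ?(negbTE nv) ?orbF.
Qed.

Lemma hat_delta_graded (F : numClosedFieldType) n (G : multigraph)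
    (Gamma : ribbon_graph G) (x y : generator n Gamma) :
  (hat_delta F n Gamma (basis_vector F x) : hatC F n Gamma) y != 0 ->
  weight (tag y) = (weight (tag x)).+1.
Proof.
rewrite linear_ofE (bigD1 x) //= big1 ?addr0 => [|z /negbTE zx]; last first.
  by rewrite ffunE zx mul0r.
rewrite ffunE eqxx mul1r /hat_delta_coef.
have [v /andP[nv /eqP yE] _|none] :=
  pickP (fun v => ~~ tag x v && (tag y == raise (tag x) v)).
  by rewrite -(weight_raise nv); congr weight.
by rewrite big_pred0 // eqxx.
Qed.

Lemma euler_VCH2 (F : numClosedFieldType) (G : multigraph) (Gamma : ribbon_graph G) :
  trivalent G -> (loop G -> False) ->
  euler_VCH F 2 Gamma =
  \sum_(nu : vstate G) (-1) ^+ weight nu *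
     (2 ^ #|boundary (add_twists Gamma (alpha_of nu))|)%N%:Z.
Proof.
move=> tri noloop.
have := @euler_homology F (generator 2 Gamma) (fun x => weight (tag x)) #|vertex G|
  (fun x => max_card _) (hat_delta F 2 Gamma) (hat_delta_sq tri noloop)
  (@hat_delta_graded F 2 G Gamma).
rewrite /euler_VCH => ->.
transitivity (\sum_(nu : vstate G) \sum_(k : monomial 2 Gamma (alpha_of nu))
    (-1) ^+ weight nu : int).
  by rewrite (sig_big_dep _ (fun _ => xpredT)).
(* Each state contributes 2^(number of circles) generators, all in degree [weight nu]. *)
apply: eq_bigr => nu _; rewrite sumr_const -mulr_natr natz; congr (_ * Posz _).
by rewrite card_ffun card_ord card_sig.
Qed.

(** A connected graph without vertices is a single circle; its plane ribbon graph is an annulus,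
    with Euler characteristic 4 but only 3 colorings. It is excluded by [vertex_gt0]. *)
Theorem theoremC (R : realType) (G : multigraph) (Gamma : ribbon_graph G)
    (vertex_gt0 : (0 < #|vertex G|)%N)
    (G_connected : connected G) (G_planar : planar G) (G_trivalent : trivalent G)
    (Gamma_plane : plane Gamma) :
  euler_VCH R[i] 2 Gamma =
    (2 ^ (#|vertex G|./2) * #|[set c : {ffun edge G -> 'I_3} | edge_coloring3 c]|)%N%:Z.
Proof.
have noloop := connected_noloop vertex_gt0 G_connected.
have [_ [[o oE] _] euler] := Gamma_plane.
rewrite (euler_VCH2 _ _ G_trivalent noloop).
apply: (state_sum_coloring G_trivalent noloop oE _ vertex_gt0 euler).
by move=> v w; apply: G_connected.2.
Qed.
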